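(* (1) In Case (A), let $\mathcal{O}_{\tau}$ be the $B_{H_{\mathbb{C}}}$-orbit on $G_{\mathbb{C}}/P_{G_{\mathbb{C}}}=\mathrm{Gr}_n(\mathbb{C}^{2n})$ corresponding to $\tau\in\mathfrak{T}^{\circ}_{n}/\mathfrak{S}_{n}$ (i.e. $\mathcal{O}_\tau=B_{H_{\mathbb{C}}}[\tau]$). Then $\mathcal{O}_{\tau}(\mathbb{R})\neq\emptyset$ if and only if $\tau\in\mathfrak{R}^{\circ}_{n}/\mathfrak{S}_{n}\subset\mathfrak{T}^{\circ}_{n}/\mathfrak{S}_{n}$. In Case (B), every orbit $\mathcal{O}_{\tau}=B_{H_{\mathbb{C}}}[\tau]$ with $\tau\in\mathfrak{R}^{\circ}_{n}/\mathfrak{S}_{n}$ has nonempty real points. (2) In Case (A) or Case (B), let $\mathcal{O}_{\tau}=B_{H_{\mathbb{C}}}[\tau]$ with $\tau\in\mathfrak{R}^{\circ}_{n}/\mathfrak{S}_{n}$. Then the number of $B_{H}$-orbits in the real points $\mathcal{O}_{\tau}(\mathbb{R})$ is $2^{d(\tau)}$, and they are parametrized by the first Galois cohomology \[ H^{1}(\mathbb{R},(B_{H_{\mathbb{C}}})_{[\tau]})\simeq\{\pm1\}^{d(\tau)}, \] where $(B_{H_{\mathbb{C}}})_{[\tau]}$ is the stabilizer of $[\tau]\in G_{\mathbb{C}}/P_{G_{\mathbb{C}}}$ in $B_{H_{\mathbb{C}}}$. Consequently \[ H\backslash(H/B_H\times G/P_G)\simeq B_{H}\backslash G/P_{G}\simeq\coprod_{\tau\in\mathfrak{R}^{\circ}_{n}/\mathfrak{S}_{n}}\{\pm1\}^{d(\tau)},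 \] and this classification is literally the same in Case (A) and Case (B).
   Context: Case (A): $G=\mathrm{U}(n,n)$ (preserving the Hermitian form $u^*J_nv$ with $J_n=\sqrt{-1}\begin{pmatrix}0&\boldsymbol 1_n\\-\boldsymbol 1_n&0\end{pmatrix}$), $H=\{\mathrm{diag}(a,(a^* )^{-1})\}\simeq\mathrm{GL}_n(\mathbb{C})$, $P_G$ the Siegel parabolic (stabilizer of $\mathbb{C}^n\oplus 0$), $B_H\simeq B_n(\mathbb{C})$ upper triangular. Complexification: $G_{\mathbb{C}}=\mathrm{GL}_{2n}(\mathbb{C})$, $H_{\mathbb{C}}=\mathrm{GL}_n(\mathbb{C})\times\mathrm{GL}_n(\mathbb{C})$ (block diagonal), $P_{G_{\mathbb{C}}}=P_{(n,n)}$ the block upper triangular maximal parabolic, $B_{H_{\mathbb{C}}}=B_n^+\times B_n^-$ (upper, resp. lower triangular), with real structure $\gamma(g)=J_n^{-1}(g^* )^{-1}J_n$. Case (B): $G=\mathrm{Sp}_{2n}(\mathbb{R})$, $H=\{\mathrm{diag}(a,{}^ta^{-1})\}\simeq\mathrm{GL}_n(\mathbb{R})$, $P_G$ the Siegel parabolic, $B_H\simeq B_n(\mathbb{R})$ upper triangular. Complexification: $G_{\mathbb{C}}=\mathrm{Sp}_{2n}(\mathbb{C})$, $H_{\mathbb{C}}\simeq\mathrm{GL}_n(\mathbb{C})$, $P_{G_{\mathbb{C}}}$ its Siegel parabolic, $B_{H_{\mathbb{C}}}\simeq B_n(\mathbb{C})$, real structure = complex conjugation. $\mathrm{PP}_n$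 = $n\times n$ partial permutation matrices (entries in $\{0,1\}$, at most one nonzero entry in each row and column). $\mathfrak{T}^{\circ}_n=\{\tau=\begin{pmatrix}\tau_1\\\tau_2\end{pmatrix}\in\mathrm{M}_{2n,n}(\mathbb{Z}):\tau_1,\tau_2\in\mathrm{PP}_n,\ \mathrm{rank}\,\tau=n\}$ and $\mathfrak{R}^{\circ}_n=\{\tau\in\mathfrak{T}^{\circ}_n:{}^t\tau_1\tau_2\text{ symmetric}\}$; $\mathfrak{S}_n$ acts by permuting columns (right multiplication), and $[\tau]$ denotes the column span of $\tau$, a point of $\mathrm{Gr}_n(\mathbb{C}^{2n})$. It is known (Fresse–Nishiyama) that $\tau\mapsto B_{H_{\mathbb{C}}}[\tau]$ gives bijections $\mathfrak{T}^{\circ}_n/\mathfrak{S}_n\simeq B_{H_{\mathbb{C}}}\backslash G_{\mathbb{C}}/P_{G_{\mathbb{C}}}$ in Case (A) and $\mathfrak{R}^{\circ}_n/\mathfrak{S}_n\simeq B_{H_{\mathbb{C}}}\backslash G_{\mathbb{C}}/P_{G_{\mathbb{C}}}$ in Case (B). $d(\tau)$ is the number of $j\in[n]$ such that the $j$-th column of $\tau_1$ equals the $j$-th column of $\tau_2$ (it is $\mathfrak{S}_n$-invariant). *)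

(* Defs.v *)
From mathcomp Require Import all_boot all_order all_fingroup all_algebra.
From mathcomp Require Export complex reals.
Set Implicit Arguments. Unset Strict Implicit. Unset Printing Implicit Defensive.
Import GRing.Theory Num.Theory.
Local Open Scope ring_scope.

Section Defs.
Variables (R : realType) (n : nat).
Local Notation C := (R[i]).
Local Notation M2 := 'M[C]_(n + n).
Local Notation Pt := 'M[C]_(n + n, n).     (* 2n x n, representing its column span *)

Definition is_pp (A : 'M[int]_n) : Prop :=
  [/\ forall i j, A i j = 0 \/ A i j = 1,
      forall i j j', A i j = 1 -> A i j' = 1 -> j = j'
    & forall i i' j, A i j = 1 -> A i' j = 1 -> i = i'].

Definition tau1 (t : 'M[int]_(n + n, n)) : 'M[int]_n := usubmx t.
Definition tau2 (t : 'M[int]_(n + n, n)) : 'M[int]_n := dsubmx t.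

(* tau viewed as a complex matrix; [tau] = its column span *)
Definition tauC (t : 'M[int]_(n + n, n)) : Pt := map_mx (fun z : int => z%:~R) t.

Definition inT (t : 'M[int]_(n + n, n)) : Prop :=
  [/\ is_pp (tau1 t), is_pp (tau2 t) & \rank (tauC t) = n].

Definition inR (t : 'M[int]_(n + n, n)) : Prop :=
  inT t /\ ((tau1 t)^T *m tau2 t)^T = (tau1 t)^T *m tau2 t.

Definition Dset (t : 'M[int]_(n + n, n)) : {set 'I_n} :=
  [set j | col j (tau1 t) == col j (tau2 t)].
Definition dtau (t : 'M[int]_(n + n, n)) : nat := #|Dset t|.

Definition rep_system (S : seq 'M[int]_(n + n, n)) : Prop :=
  [/\ forall t, t \in S -> inR t,
      forall t, inR t -> exists2 t', t' \in S & (exists s : 'S_n, t = col_perm s t')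
    & forall t t', t \in S -> t' \in S ->
        (exists s : 'S_n, t = col_perm s t') -> t = t'].

Definition span_eq (X Y : Pt) : Prop := (X^T == Y^T)%MS.

(* base point C^n (+) 0, whose stabilizer is P_{G_C} *)
Definition V0 : Pt := col_mx 1%:M 0.

Definition upper (a : 'M[C]_n) : Prop := forall i j : 'I_n, (j < i)%N -> a i j = 0.
Definition lower (a : 'M[C]_n) : Prop := forall i j : 'I_n, (i < j)%N -> a i j = 0.

Definition adj (g : M2) : M2 := (map_mx Num.conj g)^T.
Definition adjn (a : 'M[C]_n) : 'M[C]_n := (map_mx Num.conj a)^T.
Definition real_mx m p (a : 'M[C]_(m, p)) : Prop :=
  forall i j, a i j \is Num.real.

Definition J_A : M2 := 'i *: block_mx 0 1%:M (- 1%:M) 0.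
Definition gamma_A (g : M2) : M2 := invmx J_A *m invmx (adj g) *m J_A.
(* G = U(n,n) *)
Definition G_A (g : M2) : Prop := adj g *m J_A *m g = J_A.
Definition H_A (h : M2) : Prop :=
  exists2 a : 'M[C]_n, a \in unitmx & h = block_mx a 0 0 (invmx (adjn a)).
Definition BH_A (h : M2) : Prop :=
  exists a : 'M[C]_n, [/\ a \in unitmx, upper a & h = block_mx a 0 0 (invmx (adjn a))].
Definition BHC_A (b : M2) : Prop :=
  exists a1 a2 : 'M[C]_n, [/\ a1 \in unitmx, upper a1, a2 \in unitmx, lower a2
                            & b = block_mx a1 0 0 a2].
(* real points of G_C/P_C for the real structure gP |-> gamma(g)P *)
Definition real_A (X : Pt) : Prop :=
  exists g : M2, [/\ g \in unitmx, span_eq X (g *m V0) & span_eq (gamma_A g *m V0) X].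
Definition GP_A (X : Pt) : Prop := exists2 g, G_A g & span_eq X (g *m V0).

Definition J_B : M2 := block_mx 0 1%:M (- 1%:M) 0.
Definition gamma_B (g : M2) : M2 := map_mx Num.conj g.
Definition Sp_C (g : M2) : Prop := g^T *m J_B *m g = J_B.
Definition G_B (g : M2) : Prop := Sp_C g /\ real_mx g.
Definition H_B (h : M2) : Prop :=
  exists a : 'M[C]_n, [/\ a \in unitmx, real_mx a & h = block_mx a 0 0 (invmx a^T)].
Definition BH_B (h : M2) : Prop :=
  exists a : 'M[C]_n, [/\ a \in unitmx, upper a, real_mx a
                        & h = block_mx a 0 0 (invmx a^T)].
Definition BHC_B (b : M2) : Prop :=
  exists a : 'M[C]_n, [/\ a \in unitmx, upper a & b = block_mx a 0 0 (invmx a^T)].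
(* real points of Sp_2n(C)/P_C for complex conjugation *)
Definition real_B (X : Pt) : Prop :=
  exists g : M2, [/\ Sp_C g, span_eq X (g *m V0) & span_eq (gamma_B g *m V0) X].
Definition GP_B (X : Pt) : Prop := exists2 g, G_B g & span_eq X (g *m V0).

Section Generic.
Variables (BHC BH Hgrp : M2 -> Prop) (gamma : M2 -> M2) (realpt : Pt -> Prop).

Definition Borbit (t : 'M[int]_(n + n, n)) (X : Pt) : Prop :=
  exists2 b, BHC b & span_eq X (b *m tauC t).

Definition Bstab (t : 'M[int]_(n + n, n)) (s : M2) : Prop :=
  BHC s /\ span_eq (s *m tauC t) (tauC t).

(* Galois 1-cocycles of Gal(C/R) in the stabilizer, and cohomology relation *)
Definition cocycle t (c : M2) : Prop := Bstab t c /\ c *m gamma c = 1%:M.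
Definition cohom t (c c' : M2) : Prop :=
  exists2 s, Bstab t s & c' = invmx s *m c *m gamma s.

Definition BHequiv (X Y : Pt) : Prop := exists2 h, BH h & span_eq (h *m X) Y.

(* H-diagonal equivalence on H/B_H x G/P, pairs (h B_H, X) *)
Definition Hequiv (p q : M2 * Pt) : Prop :=
  exists k, [/\ Hgrp k, BH (invmx (k *m p.1) *m q.1) & span_eq (k *m p.2) q.2].

(* Part (2) for a given tau: B_H\O_tau(R) parametrized by H^1(R,(B_{H_C})_[tau])
   via  b[tau] |-> class of b^-1 gamma(b),  H^1 = {+-1}^{d(tau)},
   and #(B_H\O_tau(R)) = 2^{d(tau)} (orbits <-> subsets of Dset t). *)
Definition real_orbit_classification (t : 'M[int]_(n + n, n)) : Prop :=
  [/\
      (forall b, BHC b -> realpt (b *m tauC t) -> cocycle t (invmx b *m gamma b)),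
      (forall b b', BHC b -> BHC b' -> realpt (b *m tauC t) -> realpt (b' *m tauC t) ->
         (BHequiv (b *m tauC t) (b' *m tauC t) <->
          cohom t (invmx b *m gamma b) (invmx b' *m gamma b'))),
      (forall c, cocycle t c ->
         exists b, [/\ BHC b, realpt (b *m tauC t) & cohom t c (invmx b *m gamma b)]),
      (exists psi : {set 'I_n} -> M2,
         [/\ forall e : {set 'I_n}, e \subset Dset t -> cocycle t (psi e),
             forall c, cocycle t c -> exists2 e : {set 'I_n}, e \subset Dset t & cohom t c (psi e)
           & forall e e' : {set 'I_n}, e \subset Dset t -> e' \subset Dset t ->
               cohom t (psi e) (psi e') -> e = e'])
    &
      (exists Phi : {set 'I_n} -> Pt,
         [/\ forall e : {set 'I_n}, e \subset Dset t -> Borbit t (Phi e) /\ realpt (Phi e),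
             forall X, Borbit t X -> realpt X ->
               exists2 e : {set 'I_n}, e \subset Dset t & BHequiv X (Phi e)
           & forall e e' : {set 'I_n}, e \subset Dset t -> e' \subset Dset t ->
               BHequiv (Phi e) (Phi e') -> e = e'])].

Definition global_classification (GP : Pt -> Prop) : Prop :=
  [/\ (* H\(H/B_H x G/P) ~ B_H\G/P via X |-> (B_H, X) *)
      (forall h X, Hgrp h -> GP X -> exists2 Y, GP Y & Hequiv (h, X) (1%:M, Y)),
      (forall X Y, GP X -> GP Y -> (Hequiv (1%:M, X) (1%:M, Y) <-> BHequiv X Y))
    &
      forall S, rep_system S ->
      exists Phi : 'M[int]_(n + n, n) -> {set 'I_n} -> Pt,
        [/\ forall t (e : {set 'I_n}), t \in S -> e \subset Dset t -> GP (Phi t e),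
            forall X, GP X -> exists t, exists e : {set 'I_n},
               [/\ t \in S, e \subset Dset t & BHequiv X (Phi t e)]
          & forall t t' (e e' : {set 'I_n}), t \in S -> t' \in S -> e \subset Dset t ->
               e' \subset Dset t' -> BHequiv (Phi t e) (Phi t' e') -> t = t' /\ e = e']].
End Generic.
End Defs.

(* Main.v *)
(* Real points are the Lagrangians X = (X1; X2), i.e. X1^* X2 is Hermitian, so
   everything follows from a normal form for Lagrangians under B_H. Over a field
   with involution (C with conjugation in Case (A), R with the identity in
   Case (B)) an echelon form brings X2 to a diagonal projector 1 - P; then
   X = (P + Z; 1 - P) with Z Hermitian and PZ = 0, and symmetric elimination from
   the last row turns Z into a symmetric partial permutation matrix with signs on
   the diagonal. This is a tau in R_n together with a set e of sign changes inside
   its d(tau) fixed columns.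
   Distinct tau lie in distinct B_{H_C}-orbits: if b tau = tau' u, a nonzero term
   of det u gives a permutation along which the positions of the nonzero entries
   move monotonically, hence stay put. Distinct signs are separated by comparing
   two diagonal entries, whose quotient is |a_ii|^2 > 0.
   The cohomological statement is then formal, since H^1(R, B_{H_C}) is trivial
   (Hilbert 90). *)

Require Import Defs.
From mathcomp Require Import all_boot all_order all_fingroup all_algebra.
From mathcomp Require Import complex reals.
From mathcomp Require Import ring.
Set Implicit Arguments. Unset Strict Implicit. Unset Printing Implicit Defensive.
Import GRing.Theory Num.Theory.
Local Open Scope ring_scope.

(** The signs survive exactly in the d(tau) columns whose two entries 1 share a row, because B_H
    multiplies the quotient of these entries by a positive number only; the sign of an off-diagonal
    pair in Z is absorbed by rescaling. Over the complex numbers the signs disappear as well: a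
    torus element with entries ['i], combined with a column scaling by ['i], produces -1 in the
    upper block and 1 in the lower one. Hence all signed forms of one tau lie in a single complex
    orbit.

    The two cases have different groups, and the common part of the argument is a sandwich. The
    groups of Case (B) embed in those of Case (A): the torus elements that remove signs are found in
    the smaller complex Borel subgroup, while distinct tau and distinct signs are already separated
    by the larger groups. What remains specific to each case is the field of the normal form, the
    triviality of the cohomology of the Borel subgroup, and the translation of being real for [b
    [tau]] into the condition that [b^-1 gamma(b)] stabilizes [[tau]]. *)

Section UpperTriangular.
Variables (K : fieldType) (n : nat).
Implicit Types a b : 'M[K]_n.

(* Convertible to [upper] over the complex numbers; Case (B) also needs it over
   the reals. *)
Definition upper_mx a : Prop := forall i j : 'I_n, (j < i)%N -> a i j = 0.

Lemma upper_mx1 : upper_mx 1%:M.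
Proof. by move=> i j ltji; rewrite mxE -val_eqE /= gtn_eqF. Qed.

Lemma upper_mxM a b : upper_mx a -> upper_mx b -> upper_mx (a *m b).
Proof.
move=> ua ub i j ltji; rewrite mxE big1 // => k _.
have [ltki | leik] := ltnP k i; first by rewrite ua ?mul0r.
by rewrite ub ?mulr0 //; apply: leq_trans leik.
Qed.

(* An invertible map preserving a coordinate flag maps each step of it onto
   itself, hence so does the inverse. *)
Lemma upper_mxV a : a \in unitmx -> upper_mx a -> upper_mx (invmx a).
Proof.
move=> a_unit ua i j ltji.
pose D : 'M[K]_n := diag_mx (\row_k (i <= k)%N%:R).
have DE b k l : (D *m b) k l = (i <= k)%N%:R * b k l.
  by rewrite mul_diag_mx !mxE.
have ED b k l : (b *m D) k l = b k l * (i <= l)%N%:R.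
  by rewrite mul_mx_diag !mxE.
have DaD : D *m a = D *m a *m D.
  apply/matrixP=> k l; rewrite ED DE.
  have [lei | ltli] := leqP i l; first by rewrite mulr1.
  rewrite mulr0; have [leik | _] := leqP i k; last by rewrite mul0r.
  by rewrite ua ?mulr0 //; apply: leq_trans ltli leik.
have /submxP[B DB] : (D <= D *m a)%MS.
  have sDa : (D *m a <= D)%MS by rewrite DaD submxMl.
  have eqr : \rank (D *m a) = \rank D by rewrite mxrankMfree // row_free_unit.
  by rewrite -(geq_leqif (mxrank_leqif_sup sDa)) eqr.
have := DE (invmx a) i j; rewrite leqnn mul1r => <-.
by rewrite {1}DB !mulmxA mulmxK // ED leqNgt ltji mulr0.
Qed.

Lemma upper_mx_unit a :
  upper_mx a -> (forall i, a i i != 0) -> a \in unitmx.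
Proof.
move=> ua nz; rewrite unitmxE unitfE -det_tr det_trig.
  by apply/prodf_neq0=> i _; rewrite mxE.
by apply/is_trig_mxP=> i j ltij; rewrite mxE ua.
Qed.

Lemma upper_mx_inv_diag a i :
  a \in unitmx -> upper_mx a -> a i i * invmx a i i = 1.
Proof.
move=> a_unit ua; have uV := upper_mxV a_unit ua.
have: (a *m invmx a) i i = 1 by rewrite mulmxV // mxE eqxx.
rewrite mxE (bigD1 i) //= big1 ?addr0 // => k neq_ki.
have [ltki | ] := ltnP k i; first by rewrite ua ?mul0r.
by rewrite leq_eqVlt val_eqE eq_sym (negPf neq_ki) /= => /uV->; rewrite mulr0.
Qed.

End UpperTriangular.

(** * Normal forms over a field with involution *)

Section Hermitian.
Variables (K : fieldType) (sigma : {rmorphism K -> K}).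
Hypothesis sigmaK : involutive sigma.

Definition ctr m p (A : 'M[K]_(m, p)) : 'M[K]_(p, m) := (map_mx sigma A)^T.
Local Notation "A ^ct" := (ctr A) (at level 2, format "A ^ct").

Lemma ctrE m p (A : 'M[K]_(m, p)) i j : A^ct i j = sigma (A j i).
Proof. by rewrite !mxE. Qed.

Lemma ctrK m p (A : 'M[K]_(m, p)) : A^ct^ct = A.
Proof. by apply/matrixP=> i j; rewrite !ctrE sigmaK. Qed.

Lemma ctrM m p q (A : 'M[K]_(m, p)) (B : 'M[K]_(p, q)) :
  (A *m B)^ct = B^ct *m A^ct.
Proof. by rewrite /ctr map_mxM trmx_mul. Qed.

Lemma ctrD m p (A B : 'M[K]_(m, p)) : (A + B)^ct = A^ct + B^ct.
Proof. by rewrite /ctr map_mxD linearD. Qed.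

Lemma ctrB m p (A B : 'M[K]_(m, p)) : (A - B)^ct = A^ct - B^ct.
Proof. by rewrite /ctr map_mxB linearB. Qed.

Lemma ctrZ m p k (A : 'M[K]_(m, p)) : (k *: A)^ct = sigma k *: A^ct.
Proof. by rewrite /ctr map_mxZ linearZ. Qed.

Lemma ctr1 m : (1%:M : 'M[K]_m)^ct = 1%:M.
Proof. by rewrite /ctr map_mx1 trmx1. Qed.

Lemma ctr_delta m p i j : (delta_mx i j : 'M[K]_(m, p))^ct = delta_mx j i.
Proof. by rewrite /ctr map_delta_mx trmx_delta. Qed.

Lemma ctr_unit m (A : 'M[K]_m) : (A^ct \in unitmx) = (A \in unitmx).
Proof. by rewrite unitmx_tr map_unitmx. Qed.

Lemma ctrV m (A : 'M[K]_m) : (invmx A)^ct = invmx A^ct.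
Proof. by rewrite /ctr map_invmx trmx_inv. Qed.

Variable n : nat.
Implicit Types (A B : {set 'I_n}) (Z b : 'M[K]_n) (Q : 'M[int]_n).

(** Signs are allowed on the diagonal only: an off-diagonal pair spans a hyperbolic plane, which has
    no sign invariant. By symmetry the condition on rows also holds for columns. *)
Definition spp Q : Prop :=
  [/\ Q^T = Q,
      forall i j j', Q i j != 0 -> Q i j' != 0 -> j = j',
      forall i j, [\/ Q i j = 0, Q i j = 1 | Q i j = -1]
    & forall i j, Q i j = -1 -> i = j].

(** This is the projector [P] of the normal form. Projecting outside [A] lets one write that the
    rows of [Z] are supported in [A] as [coproj A *m Z = 0]. *)
Definition coproj A : 'M[K]_n := diag_mx (\row_i (i \notin A)%:R).

Lemma coproj_mulE A m (Z : 'M[K]_(n, m)) i j :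
  (coproj A *m Z) i j = (i \notin A)%:R * Z i j.
Proof. by rewrite mul_diag_mx !mxE. Qed.

Lemma mul_coprojE A m (Z : 'M[K]_(m, n)) i j :
  (Z *m coproj A) i j = Z i j * (j \notin A)%:R.
Proof. by rewrite mul_mx_diag !mxE. Qed.

Lemma coproj_ctr A : (coproj A)^ct = coproj A.
Proof.
apply/matrixP=> i j; rewrite !mxE eq_sym.
by case: eqP => [->|]; rewrite ?rmorph0 // !mulr1n rmorph_nat.
Qed.

Lemma coprojM A B : B \subset A -> coproj A *m coproj B = coproj A.
Proof.
move=> sBA; apply/matrixP=> i j; rewrite mul_coprojE !mxE.
case: eqP => [<-|]; last by rewrite mul0r.
rewrite !mulr1n; case: (boolP (i \in A)) => Ai /=; first by rewrite mul0r.
by rewrite (contra (subsetP sBA i)) ?mulr1.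
Qed.

Lemma coproj_id A : coproj A *m coproj A = coproj A.
Proof. exact: coprojM. Qed.

Lemma coproj0P A m (Z : 'M[K]_(n, m)) :
  coproj A *m Z = 0 <-> (forall i j, i \notin A -> Z i j = 0).
Proof.
split=> [PZ0 i j Ai | Z0].
  by have := coproj_mulE A Z i j; rewrite PZ0 Ai mul1r mxE.
apply/matrixP=> i j; rewrite coproj_mulE mxE.
by have [Ai|Ai] := boolP (i \in A); rewrite ?mul0r // mul1r Z0.
Qed.

Lemma coproj_delta A m i (j : 'I_m) :
  i \notin A -> coproj A *m delta_mx i j = delta_mx i j.
Proof.
move=> Ai; apply/matrixP=> k l; rewrite coproj_mulE !mxE.
by case: eqP => [->|]; rewrite ?Ai ?mul1r ?mulr0.
Qed.

(** The arithmetic input of the normal form: 2 is inverted to straighten a hyperbolic plane, and the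
    second hypothesis, which follows from square roots of positive reals, rescales a diagonal pivot
    to 1 or -1. *)
Hypothesis two_neq0 : (2 : K) != 0.
Hypothesis norm_or_oppnorm : forall x, sigma x = x -> x != 0 ->
  exists y, y * sigma y * x = 1 \/ y * sigma y * x = -1.

Local Notation intK := (map_mx (fun z : int => z%:~R : K)).

(* [coproj A *m b = coproj A] and its mirror say that [b] is the identity
   outside [A]. *)
Definition herm_normal A Z : Prop :=
  exists b Q,
    [/\ [/\ upper_mx b, b \in unitmx, coproj A *m b = coproj A
          & b *m coproj A = coproj A],
        spp Q, forall i j, i \notin A -> Q i j = 0
      & Z = b *m intK Q *m b^ct].

(** Common end of the three branches of the induction. The split off block [R] is fixed by the inner
    base change [b'], so [b'] factors out of both summands and the two base changes compose. *)
Lemma herm_normal_step A B Z b b' Q' R :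
    B \subset A -> upper_mx b -> b \in unitmx ->
    coproj A *m b = coproj A -> b *m coproj A = coproj A ->
    upper_mx b' -> b' \in unitmx ->
    coproj B *m b' = coproj B -> b' *m coproj B = coproj B ->
    spp (Q' + R) -> (forall i j, i \notin A -> (Q' + R) i j = 0) ->
    b' *m intK R *m b'^ct = intK R ->
    Z = b *m (b' *m intK Q' *m b'^ct + intK R) *m b^ct ->
  herm_normal A Z.
Proof.
move=> sBA ub b_unit Pb bP ub' b'_unit Pb' b'P sppQ QA b'R ->.
exists (b *m b'), (Q' + R); split=> //.
- split; first exact: upper_mxM.
  + by rewrite unitmx_mul b_unit.
  + by rewrite mulmxA Pb -(coprojM sBA) -mulmxA Pb'.
  + rewrite -mulmxA -[in b' *m _](coproj_id A) -{1}(coproj_ctr A).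
    have BA : coproj B *m coproj A = coproj A.
      by rewrite -(coproj_ctr A) -(coproj_ctr B) -ctrM coprojM.
    by rewrite coproj_ctr coproj_id -{1}BA (mulmxA b') b'P BA.
rewrite ctrM (map_mxD (intmul 1 : {rmorphism int -> K})) mulmxA -!mulmxA.
congr (_ *m _); rewrite !mulmxA.
by congr (_ *m _); rewrite mulmxDr mulmxDl b'R.
Qed.

Lemma spp_sym Q i j : spp Q -> Q i j = Q j i.
Proof. by case=> QT _ _ _; rewrite -{1}QT mxE. Qed.

Lemma spp0 : spp 0.
Proof.
split=> [|i j j'|i j|i j]; rewrite ?trmx0 ?mxE ?eqxx //.
by constructor.
Qed.

Lemma spp_add_diag Q m (e : int) :
  spp Q -> (forall j, Q m j = 0) -> e = 1 \/ e = -1 ->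
  spp (Q + e *: delta_mx m m).
Proof.
move=> sppQ Qm0 eE; have [QT Qfun Qval Qneg] := sppQ.
have Qm0' j : Q j m = 0 by rewrite spp_sym.
have E i j : (Q + e *: delta_mx m m) i j
    = if (i == m) && (j == m) then e else Q i j.
  rewrite !mxE; case: (eqVneq i m) => [->|_] /=; last by rewrite mulr0 addr0.
  by rewrite Qm0 add0r; case: (j == m); rewrite ?mulr1 ?mulr0.
split=> [|i j j'|i j|i j]; rewrite ?E.
- by rewrite linearD linearZ /= trmx_delta QT.
- case: (eqVneq i m) => [->|_] /=; last exact: Qfun.
  rewrite !Qm0; case: (eqVneq j m) => [->|_] //=.
  by case: (eqVneq j' m) => [->|_] //=.
- case: ifP => _; last exact: Qval.
  by case: eE => ->; [constructor 2 | constructor 3].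
- by case: ifP => [/andP[/eqP-> /eqP->] //|_]; apply: Qneg.
Qed.

Lemma spp_add_swap Q m p :
  spp Q -> (forall j, Q m j = 0) -> (forall j, Q p j = 0) -> m != p ->
  spp (Q + (delta_mx m p + delta_mx p m)).
Proof.
move=> sppQ Qm0 Qp0 neq_mp; have [QT Qfun Qval Qneg] := sppQ.
have E i j : (Q + (delta_mx m p + delta_mx p m)) i j
    = if i == m then (j == p)%:R else if i == p then (j == m)%:R else Q i j.
  rewrite !mxE; case: (eqVneq i m) => [->|_] /=.
    by rewrite Qm0 (negPf neq_mp) add0r addr0.
  by case: (eqVneq i p) => [->|_] /=; rewrite ?Qp0 ?add0r ?addr0.
split=> [|i j j'|i j|i j]; rewrite ?E.
- by rewrite !linearD /= !trmx_delta QT [X in _ + X]addrC.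
- have b01 k : ((j == k)%:R : int) != 0 -> ((j' == k)%:R : int) != 0 -> j = j'.
    by case: (eqVneq j k) => [->|_] //; case: (eqVneq j' k) => [->|_].
  case: (i == m); first exact: b01.
  by case: (i == p); [exact: b01 | exact: Qfun].
- case: (i == m); first by case: (j == p); constructor.
  by case: (i == p); [case: (j == m); constructor | apply: Qval].
- case: (i == m); first by case: (j == p).
  by case: (i == p); [case: (j == m) | apply: Qneg].
Qed.

Local Notation e_ m := (delta_mx m ord0 : 'cV[K]_n).

Implicit Types (m : 'I_n) (f : 'cV[K]_n).

(** The identity with column [m] replaced by [f]. The form of a rank one update shows at once that
    vectors vanishing at [m] are fixed. *)
Definition repl_col m (f : 'cV[K]_n) : 'M[K]_n :=
  1%:M + (f - e_ m) *m (e_ m)^ct.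

Lemma e_ctM m p (Z : 'M[K]_(n, p)) i j : ((e_ m)^ct *m Z) i j = Z m j.
Proof. by rewrite ctr_delta (ord1 i) -rowE mxE. Qed.

Lemma e_ctMv m (v : 'cV[K]_n) : (e_ m)^ct *m v = (v m ord0)%:M.
Proof.
by apply/matrixP=> i j; rewrite ctr_delta -rowE !ord1 !mxE eqxx mulr1n.
Qed.

Lemma repl_colE m f k l :
  repl_col m f k l = if l == m then f k ord0 else (k == l)%:R.
Proof.
rewrite !mxE big_ord1 ctr_delta !mxE !eqxx /= andbT.
case: (eqVneq l m) => [->|_]; rewrite ?mulr1 ?mulr0 ?addr0 //.
by rewrite addrC subrK.
Qed.

Lemma repl_col_mul m f p (v : 'M[K]_(n, p)) :
  (e_ m)^ct *m v = 0 -> repl_col m f *m v = v.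
Proof. by move=> mv0; rewrite mulmxDl mul1mx -mulmxA mv0 mulmx0 addr0. Qed.

Lemma repl_col_e m f : repl_col m f *m e_ m = f.
Proof.
rewrite mulmxDl mul1mx -mulmxA e_ctMv mxE !eqxx mulmx1.
by rewrite addrC subrK.
Qed.

Lemma repl_col_upper m f :
  (forall k : 'I_n, (m < k)%N -> f k ord0 = 0) -> upper_mx (repl_col m f).
Proof.
move=> f0 i j ltji; rewrite repl_colE; case: eqP => [ejm|_].
  by apply: f0; rewrite -ejm.
by rewrite -val_eqE /= gtn_eqF.
Qed.

Lemma repl_col_unit m f :
  (forall k : 'I_n, (m < k)%N -> f k ord0 = 0) -> f m ord0 != 0 ->
  repl_col m f \in unitmx.
Proof.
move=> f0 fm; apply: upper_mx_unit; first exact: repl_col_upper.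
by move=> i; rewrite repl_colE; case: (eqVneq i m) => [->|_]; rewrite ?eqxx ?oner_eq0.
Qed.

Lemma coproj_e A m : m \in A -> coproj A *m e_ m = 0.
Proof.
move=> Am; apply/coproj0P=> i j Ai; rewrite mxE.
by case: (eqVneq i m) => // eim; rewrite eim Am in Ai.
Qed.

Lemma coproj_repl A m f :
  m \in A -> coproj A *m f = 0 -> coproj A *m repl_col m f = coproj A.
Proof.
move=> Am f0.
by rewrite mulmxDr mulmx1 mulmxA mulmxBr f0 coproj_e // subr0 mul0mx addr0.
Qed.

Lemma repl_coproj A m f :
  m \in A -> repl_col m f *m coproj A = coproj A.
Proof.
move=> Am; apply: repl_col_mul.
by rewrite -(coproj_ctr A) -ctrM coproj_e // /ctr map_mx0 trmx0.
Qed.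

Lemma herm_entry Z i j : Z^ct = Z -> Z i j = sigma (Z j i).
Proof. by move=> ZH; rewrite -{1}ZH ctrE. Qed.

Lemma coproj_setD1 A m Z :
  coproj A *m Z = 0 -> (e_ m)^ct *m Z = 0 -> coproj (A :\ m) *m Z = 0.
Proof.
move=> /coproj0P AZ mZ; apply/coproj0P=> i j; rewrite !inE negb_and negbK.
by case/orP=> [/eqP->|/AZ->//]; rewrite -(e_ctM m Z ord0) mZ mxE.
Qed.

Lemma fix_delta A b i j : b *m coproj A = coproj A -> i \notin A ->
  b *m (delta_mx i j : 'M_n) = delta_mx i j.
Proof. by move=> bP Ai; rewrite -(coproj_delta j Ai) mulmxA bP. Qed.

Lemma fix_delta2 A b i j : b *m coproj A = coproj A ->
  i \notin A -> j \notin A ->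
  b *m (delta_mx i j : 'M_n) *m b^ct = delta_mx i j.
Proof.
move=> bP Ai Aj; rewrite (fix_delta _ bP) //.
by rewrite -(ctr_delta j i) -ctrM (fix_delta _ bP).
Qed.

Lemma intK_delta i j : intK (delta_mx i j : 'M_n) = delta_mx i j.
Proof. exact: (map_delta_mx (intmul 1 : {rmorphism int -> K})). Qed.

(* Induction on the support [A]; [m] is its largest index. Either [Z m m] is an
   invertible pivot and one splits off the Schur complement, or the last nonzero
   entry [Z m p] of row [m] gives a hyperbolic plane [f z^* + z f^*], with [f] and
   [z] combinations of columns [m] and [p]. Taking [m] and [p] largest keeps the
   base change upper triangular. *)
Lemma herm_nf A Z : Z^ct = Z -> coproj A *m Z = 0 -> herm_normal A Z.
Proof.
elim: {A}_.+1 {-2}A (ltnSn #|A|) Z => // N IH A; rewrite ltnS => leAN Z ZH AZ.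
have [A0|[i0 Ai0]] := set_0Vmem A.
  have Z0 : Z = 0.
    by apply/matrixP=> i j; rewrite mxE (iffLR (coproj0P A Z) AZ) // A0 inE.
  exists 1%:M, 0; split; [|exact: spp0|by move=> i j _; rewrite mxE|].
    split; [exact: upper_mx1|exact: unitmx1|exact: mulmx1|exact: mul1mx].
  by rewrite Z0 mul1mx ctr1 mulmx1 map_mx0.
have [m Am maxm] := arg_maxnP (fun i : 'I_n => i : nat) Ai0.
have {}Am : m \in A by [].
have Zout k l : k \notin A -> Z k l = 0 by move: k l; apply/coproj0P.
have gtm (k l : 'I_n) : (m < k)%N -> Z k l = 0.
  by move=> ltmk; apply: Zout; apply/negP=> /maxm /=; rewrite leqNgt ltmk.
pose z := Z *m e_ m.
have zE k : z k ord0 = Z k m by rewrite /z -colE mxE.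
have zct : z^ct = (e_ m)^ct *m Z by rewrite /z ctrM ZH.
have Az : coproj A *m z = 0 by rewrite mulmxA AZ mul0mx.
clearbody z.
have sB : A :\ m \subset A := subD1set _ _.
have cB : (#|A :\ m| < N)%N.
  by move: leAN; rewrite (cardsD1 m) Am.
have mB : m \notin A :\ m by rewrite !inE eqxx.
have [Zm0|[j Zmj]] : (forall j, Z m j = 0) \/ exists j, Z m j != 0.
  have [/existsP[j nz]|/existsPn nn] := boolP [exists j, Z m j != 0].
    by right; exists j.
  by left=> j; apply/eqP; have := nn j; rewrite negbK.
  have BZ : coproj (A :\ m) *m Z = 0.
    apply: coproj_setD1 => //; apply/matrixP=> i j.
    by rewrite e_ctM Zm0 mxE.
  have [b [Q [[ub b_unit Pb bP] sQ QB ->]]] := IH _ cB _ ZH BZ.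
  apply: (@herm_normal_step A (A :\ m) _ 1%:M b Q 0) => //.
  + exact: upper_mx1.
  + exact: unitmx1.
  + exact: mulmx1.
  + exact: mul1mx.
  + by rewrite addr0.
  + move=> i j Ai; rewrite addr0; apply: QB.
    by apply: contra Ai; apply: (subsetP sB).
  + by rewrite map_mx0 mulmx0 mul0mx.
  + by rewrite map_mx0 addr0 ctr1 mul1mx mulmx1.
have [Zmm|Zmm] := eqVneq (Z m m) 0; last first.
  have sx : sigma (Z m m) = Z m m by rewrite -herm_entry.
  have [y yE] := norm_or_oppnorm sx Zmm.
  pose e : int := if y * sigma y * Z m m == 1 then 1 else -1.
  have ee : e = 1 \/ e = -1 by rewrite /e; case: ifP; [left|right].
  have eK : (e%:~R : K) = y * sigma y * Z m m.
    rewrite /e; case: eqP => [->//|ne1]; case: yE => [//|->].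
    by rewrite rmorphN.
  have y0 : y != 0.
    by apply/eqP=> y0; move: yE; rewrite y0 !mul0r => -[] /eqP;
       rewrite eq_sym ?oppr_eq0 oner_eq0.
  have e2 : (e%:~R * e%:~R : K) = 1.
    by case: ee => ->; rewrite ?rmorphN ?mulrNN mulr1.
  pose Z' := Z - (Z m m)^-1 *: (z *m z^ct).
  have Z'm : (e_ m)^ct *m Z' = 0.
    rewrite mulmxBr -scalemxAr mulmxA e_ctMv zE -zct.
    by rewrite mul_scalar_mx scalerA mulVf // scale1r subrr.
  have Z'H : Z'^ct = Z'.
    by rewrite ctrB ctrZ ctrM ctrK ZH fmorphV sx.
  have AZ' : coproj A *m Z' = 0.
    by rewrite mulmxBr AZ -scalemxAr mulmxA Az mul0mx scaler0 subr0.
  have [b' [Q [[ub b_unit Pb bP] sQ QB Z'E]]] :=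
    IH _ cB _ Z'H (coproj_setD1 AZ' Z'm).
  (* With this scaling [e f f^*] is the term [(Z m m)^-1 z z^*] removed from [Z], because [e] is its
     own inverse. *)
  pose f := y *: z.
  have fm (k : 'I_n) : (m < k)%N -> f k ord0 = 0.
    by move=> ltmk; rewrite mxE zE gtm // mulr0.
  apply: (@herm_normal_step A (A :\ m) _ (repl_col m f) b' Q
            (e *: delta_mx m m)) => //.
  + exact: repl_col_upper.
  + by apply: repl_col_unit => //; rewrite mxE zE mulf_neq0.
  + by apply: coproj_repl => //; rewrite -scalemxAr Az scaler0.
  + exact: repl_coproj.
  + by apply: spp_add_diag => // j'; apply: QB.
  + move=> i j' Ai; rewrite mxE QB; last by apply: contra Ai; apply/subsetP.
    rewrite !mxE; case: eqP => [eim|]; last by rewrite mulr0 addr0.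
    by rewrite eim Am in Ai.
  + rewrite (map_mxZ (intmul 1 : {rmorphism int -> K})) /= intK_delta.
    by rewrite -scalemxAr -scalemxAl (fix_delta2 bP).
  rewrite -Z'E (map_mxZ (intmul 1 : {rmorphism int -> K})) /= intK_delta.
  rewrite mulmxDr mulmxDl (repl_col_mul _ Z'm).
  have -> : Z' *m (repl_col m f)^ct = Z'.
    by rewrite -[in LHS]Z'H -ctrM repl_col_mul.
  rewrite -(mul_delta_mx (ord0 : 'I_1)) -scalemxAr mulmxA repl_col_e.
  rewrite -scalemxAl -(ctr_delta m ord0) -mulmxA -ctrM repl_col_e.
  rewrite /f ctrZ -scalemxAl -scalemxAr !scalerA /Z'.
  have -> : e%:~R * y * sigma y = (Z m m)^-1.
    apply: (mulIf Zmm); rewrite mulVf // -!mulrA (mulrA y) -eK.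
    by rewrite e2.
  by rewrite subrK.
have [p Zmp maxp] := @arg_maxnP _ j (fun k => Z m k != 0) (@nat_of_ord n) Zmj.
have {}Zmp : Z m p != 0 by [].
have neq_pm : p != m by apply: contraNneq Zmp => ->; rewrite Zmm.
have Ap : p \in A.
  by apply: contraNT Zmp => Ap; rewrite herm_entry // Zout // rmorph0.
have zp : Z p m != 0 by rewrite herm_entry // fmorph_eq0.
have szp : sigma (Z p m) = Z m p by rewrite -herm_entry.
have srr : sigma (Z p p) = Z p p by rewrite -herm_entry.
(* Row [p] of the remainder [Z'] below is [-(f_p + Z p m * sigma d) z^*], where
   [f_p = Z p p / Z m p + d * Z p m]. This [d] makes it vanish. *)
pose d := - (Z p p / (2 * Z p m * Z m p)).
have sd : sigma d = d.
  rewrite rmorphN fmorph_div !rmorphM rmorph_nat srr szp -(herm_entry p m ZH).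
  by rewrite mulrAC.
pose w := Z *m e_ p.
have wE k : w k ord0 = Z k p by rewrite /w -colE mxE.
have wct : w^ct = (e_ p)^ct *m Z by rewrite /w ctrM ZH.
have Aw : coproj A *m w = 0 by rewrite mulmxA AZ mul0mx.
clearbody w.
pose f := (Z m p)^-1 *: w + d *: z.
have fE k : f k ord0 = (Z m p)^-1 * Z k p + d * Z k m.
  by rewrite [LHS]mxE [X in X + _]mxE [X in _ + X]mxE wE zE.
have f_m : f m ord0 = 1 by rewrite fE Zmm mulr0 addr0 mulVf.
have f_p : f p ord0 + Z p m * sigma d = 0.
  by rewrite sd fE /d; field; rewrite two_neq0 zp Zmp.
have fct : f^ct = (Z p m)^-1 *: w^ct + sigma d *: z^ct.
  by rewrite ctrD !ctrZ fmorphV -(herm_entry p m ZH).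
have zm : z m ord0 = 0 by rewrite zE.
have Af : coproj A *m f = 0 by rewrite mulmxDr -!scalemxAr Aw Az !scaler0 addr0.
clearbody f.
have fm (k : 'I_n) : (m < k)%N -> f k ord0 = 0.
  by move=> ltmk; rewrite fE (gtm k p) // (gtm k m) // !mulr0 addr0.
have gtp (k : 'I_n) : (p < k)%N -> z k ord0 = 0.
  move=> ltpk; rewrite zE herm_entry //; have [->|nz] := eqVneq (Z m k) 0.
    exact: rmorph0.
  by have := maxp k nz; rewrite /= leqNgt ltpk.
pose Z' := Z - (f *m z^ct + z *m f^ct).
have Z'm : (e_ m)^ct *m Z' = 0.
  rewrite mulmxBr mulmxDr !mulmxA !e_ctMv f_m zm -zct.
  by rewrite !mul_scalar_mx scale1r scale0r addr0 subrr.
have Z'p : (e_ p)^ct *m Z' = 0.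
  rewrite mulmxBr mulmxDr !mulmxA !e_ctMv zE -wct !mul_scalar_mx fct.
  rewrite scalerDr !scalerA mulfV // scale1r addrCA -scalerDl f_p.
  by rewrite scale0r addr0 subrr.
have Z'H : Z'^ct = Z' by rewrite ctrB ctrD !ctrM !ctrK ZH [X in _ - X]addrC.
have AZ' : coproj A *m Z' = 0.
  by rewrite mulmxBr mulmxDr AZ !mulmxA Af Az !mul0mx addr0 subr0.
have sBB : A :\ m :\ p \subset A := subset_trans (subD1set _ _) sB.
have cBB : (#|A :\ m :\ p| < N)%N.
  by apply: leq_ltn_trans cB; apply: subset_leq_card (subD1set _ _).
have mBB : m \notin A :\ m :\ p by rewrite !inE eqxx andbF.
have pBB : p \notin A :\ m :\ p by rewrite !inE eqxx.
have [b' [Q [[ub b_unit Pb bP] sQ QB Z'E]]] :=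
  IH _ cBB _ Z'H (coproj_setD1 (coproj_setD1 AZ' Z'm) Z'p).
have RE : intK (delta_mx m p + delta_mx p m) = delta_mx m p + delta_mx p m.
  by rewrite (map_mxD (intmul 1 : {rmorphism int -> K})) /= !intK_delta.
(* The second factor fixes [e_m] since [p] differs from [m], and the first fixes [z] since [z]
   vanishes at [m]. So [b] sends [e_m] to [f] and [e_p] to [z]. *)
pose b := repl_col m f *m repl_col p z.
have bm : b *m e_ m = f.
  rewrite -mulmxA (@repl_col_mul p) ?repl_col_e //.
  by apply/matrixP=> i k; rewrite e_ctM !mxE (negPf neq_pm).
have bp : b *m e_ p = z.
  by rewrite -mulmxA repl_col_e repl_col_mul // e_ctMv zm; apply: raddf0.
have bZ' : b *m Z' = Z' by rewrite -mulmxA !repl_col_mul.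
apply: (@herm_normal_step A (A :\ m :\ p) _ b b' Q
          (delta_mx m p + delta_mx p m)) => //.
- by apply: upper_mxM; apply: repl_col_upper.
- rewrite unitmx_mul !repl_col_unit //; first by rewrite zE.
  by rewrite f_m oner_eq0.
- by rewrite mulmxA !coproj_repl.
- by rewrite -mulmxA !repl_coproj.
- by apply: spp_add_swap => // [k|k|]; rewrite 1?eq_sym //; apply: QB.
- move=> i k Ai; rewrite mxE QB; last by apply: contra Ai; apply/subsetP.
  rewrite !mxE; case: (eqVneq i m) => [eim|_]; first by rewrite eim Am in Ai.
  by case: (eqVneq i p) => [eip|//]; rewrite eip Ap in Ai.
- by rewrite RE mulmxDr mulmxDl !(fix_delta2 bP).
rewrite -Z'E RE mulmxDr mulmxDl bZ'.
have -> : Z' *m b^ct = Z' by rewrite -[in LHS]Z'H -ctrM bZ'.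
rewrite -(mul_delta_mx (ord0 : 'I_1) m p) -(mul_delta_mx (ord0 : 'I_1) p m).
rewrite -(ctr_delta m ord0) -(ctr_delta p ord0) mulmxDr mulmxDl.
rewrite !(mulmxA b) bm bp -!(mulmxA _ _ b^ct) -!ctrM bm bp.
by rewrite subrK.
Qed.

Lemma subcoprojE A (d : nat) (Z : 'M[K]_(n, d)) i j :
  ((1%:M - coproj A) *m Z) i j = (i \in A)%:R * Z i j.
Proof.
rewrite mulmxBl mul1mx mxE [X in _ + X]mxE coproj_mulE.
by case: (i \in A); rewrite ?mul0r ?mul1r ?subr0 ?subrr.
Qed.

(* [A] collects the rows that do not depend on the previous ones. *)
Lemma row_echelon Z : exists l (A : {set 'I_n}) g,
  [/\ upper_mx l^T, l \in unitmx, g \in unitmx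
    & l *m Z = (1%:M - coproj A) *m g].
Proof.
pose prev (i : 'I_n) : 'M[K]_n :=
  \matrix_(k, x) (if (k < i)%N then Z k x else 0).
pose A := [set i | ~~ (row i Z <= prev i)%MS].
(* For [i] outside [A] these are coefficients of row [i] in terms of the earlier rows. Subtracting
   that combination, [l] kills the rows outside [A] and leaves those in [A] alone. *)
pose c i := row i Z *m pinvmx (prev i).
pose l : 'M[K]_n := \matrix_(i, k)
  ((i == k)%:R - ((i \notin A) && (k < i)%N)%:R * c i ord0 k).
have lE : l *m Z = (1%:M - coproj A) *m Z.
  apply/matrixP=> i x; rewrite subcoprojE mxE.
  under eq_bigr => k _ do rewrite mxE mulrBl.
  rewrite sumrB (bigD1 i) //= big1 => [|k /negPf]; last first.
    by rewrite eq_sym => ->; rewrite mul0r.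
  rewrite eqxx mul1r addr0.
  have [Ai|Ai] := boolP (i \in A).
    by rewrite big1 ?subr0 ?mul1r // => k _; rewrite !mul0r.
  have := Ai; rewrite inE negbK => /mulmxKpV /matrixP /(_ ord0 x).
  rewrite -/(c i) [RHS]mxE => <-; rewrite mul0r [X in X - _]mxE -sumrB.
  apply: big1 => k _; rewrite [prev i k x]mxE.
  by case: ifP; rewrite ?mul1r ?mul0r ?mulr0 subrr.
have utl : upper_mx l^T.
  move=> i j ltji; rewrite !mxE [(i < j)%N]ltnNge (ltnW ltji) andbF mul0r subr0.
  by rewrite -val_eqE /= ltn_eqF.
(* In a linear relation among the rows in [A], the last row that occurs would depend on earlier
   ones. So these rows are independent and can be completed to an invertible [g]. *)
have rkD : \rank ((1%:M - coproj A) *m Z) = \rank (1%:M - coproj A).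
  rewrite -(mxrank_mul_ker (1%:M - coproj A) Z).
  suff -> : ((1%:M - coproj A) :&: kermx Z)%MS = 0 by rewrite mxrank0 addn0.
  apply/eqP/rowV0P=> v; rewrite sub_capmx => /andP[/submxP[u vE] /sub_kermxP vZ].
  have vA k : k \notin A -> v ord0 k = 0.
    move=> Ak; rewrite vE mulmxBr mulmx1 mxE [X in _ + X]mxE mul_coprojE Ak.
    by rewrite mulr1 subrr.
  apply/eqP/negPn/negP=> /eqP nzv.
  have [i0 nzi0] : exists i, v ord0 i != 0.
    have [/existsP//|/existsPn v0] := boolP [exists i, v ord0 i != 0].
    by case: nzv; apply/rowP=> i; rewrite mxE; apply/eqP; rewrite -[_ == _]negbK.
  have [i nzi maxi] :=
    @arg_maxnP _ i0 (fun k => v ord0 k != 0) (@nat_of_ord n) nzi0.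
  have {}nzi : v ord0 i != 0 by [].
  have : i \in A by apply: contraNT nzi => /vA->.
  rewrite inE => /negP; apply; apply/submxP.
  exists (- (v ord0 i)^-1 *: v); apply/rowP=> x.
  have := congr1 (fun B : 'rV_n => B ord0 x) vZ; rewrite !mxE (bigD1 i) //=.
  move=> /eqP; rewrite addr_eq0 => /eqP vZi.
  apply: (mulfI nzi); rewrite vZi [X in _ = _ * X](bigD1 i) //=.
  rewrite [prev i i x]mxE ltnn mulr0 add0r.
  rewrite mulr_sumr -sumrN; apply: eq_bigr => k neq_ki.
  rewrite !mxE mulrA mulNr mulrN mulrA mulfV // mul1r.
  have [ltki|leik] := ltnP k i; first by rewrite mulNr.
  rewrite mulr0; have [->|/maxi /= leki] := eqVneq (v ord0 k) 0.
    by rewrite mul0r oppr0.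
  by case/eqP: neq_ki; apply/val_inj/eqP; rewrite /= eqn_leq leik leki.
have [g g_unit gE] := complete_unitmx rkD.
exists l, A, g; split; rewrite ?lE //.
rewrite -unitmx_tr; apply: upper_mx_unit => // i.
by rewrite !mxE eqxx ltnn andbF mul0r subr0 oner_eq0.
Qed.

(** The group acts by [a] on the upper block and by the inverse of [a^ct] on the lower one, which is
    why [a] and [a^ct] stand on opposite sides of the two equations. *)
Lemma lagrangian_nf (X1 X2 : 'M[K]_n) :
    \rank (col_mx X1 X2) = n -> X1^ct *m X2 = X2^ct *m X1 ->
  exists a u (A : {set 'I_n}) Q,
    [/\ upper_mx a, a \in unitmx, u \in unitmx,
        spp Q /\ (forall i j, i \notin A -> Q i j = 0)
      & X1 = a *m (coproj A + intK Q) *m u /\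
        a^ct *m X2 = (1%:M - coproj A) *m u].
Proof.
move=> rkX XH.
have [l [A [g [ul l_unit g_unit lX]]]] := row_echelon X2.
(* [Y] is the upper block in the coordinates where the lower one is [1 - P]. Isotropy then says that
   [(1 - P) Y] is Hermitian. *)
pose P := coproj A; pose Y := (invmx l)^ct *m X1 *m invmx g.
have PP : P *m P = P := coproj_id A.
have PH : P^ct = P := coproj_ctr A.
have X1E : X1 = l^ct *m Y *m g.
  rewrite /Y !mulmxA -ctrM mulVmx // ctr1 mul1mx mulmxKV //.
have YH : Y^ct *m (1%:M - P) = (1%:M - P) *m Y.
  have E : Y^ct *m (1%:M - P) = (invmx g)^ct *m (X1^ct *m X2) *m invmx g.
    rewrite /Y 2!ctrM ctrK -(mulmxK g_unit (1%:M - P)) -lX !mulmxA.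
    by rewrite mulmxKV.
  rewrite -{2}(ctrK Y) -[in RHS](ctr1 n) -{2}PH -ctrB -ctrM E.
  by rewrite !ctrM !ctrK XH !mulmxA.
clearbody Y.
have [Z Zdef] : exists Z, Z = (1%:M - P) *m Y by exists ((1%:M - P) *m Y).
have ZH : Z^ct = Z by rewrite Zdef ctrM ctrB ctr1 PH.
have PZ : P *m Z = 0 by rewrite Zdef mulmxA mulmxBr mulmx1 PP subrr mul0mx.
have ZP : Z *m P = 0.
  by rewrite -ZH -PH -ctrM PZ /ctr map_mx0 trmx0.
have [b [Q [[ub b_unit Pb bP] sQ QA ZE]]] := herm_nf ZH PZ.
rewrite -/P in Pb bP.
(* A column operation that reduces [Y] to [P + Z] and keeps the lower block, as [(1 - P) M = 1 - P].
   It is invertible because the whole matrix, of rank [n], factors through [M *m g]. *)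
pose M := P *m Y + (1%:M - P).
have YE : Y = (P + Z) *m M.
  rewrite /M mulmxDr !mulmxDl !mulmxA PP ZP mul0mx addr0 !mulmxBr !mulmx1.
  by rewrite PP subrr ZP subr0 add0r Zdef mulmxBl mul1mx addrC subrK.
have PM : (1%:M - P) *m M = 1%:M - P.
  have P'P : (1%:M - P) *m P = 0 by rewrite mulmxBl mul1mx PP subrr.
  by rewrite mulmxDr mulmxA mulmxBr P'P mul0mx add0r mulmx1 subr0.
have M_unit : M \in unitmx.
  rewrite -row_full_unit /row_full eqn_leq rank_leq_col -{1}rkX.
  have -> : col_mx X1 X2 = col_mx (l^ct *m (P + Z)) (invmx l *m (1%:M - P)) *m (M *m g).
    rewrite mul_col_mx; congr col_mx; first by rewrite X1E YE !mulmxA.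
    by rewrite !mulmxA -(mulmxA _ _ M) PM -mulmxA -lX mulKmx.
  by rewrite mulmxA mxrankMfree ?row_free_unit // mxrankM_maxr.
exists (l^ct *m b), (b^ct *m M *m g), A, Q; split.
- apply: upper_mxM => // i j ltji.
  by rewrite ctrE -(trmxK l) mxE ul // rmorph0.
- by rewrite unitmx_mul ctr_unit l_unit.
- by rewrite !unitmx_mul ctr_unit b_unit M_unit.
- by [].
(* Since [b] is the identity outside [A], it normalizes [Z] without disturbing the summand [P]. *)
have bPb : b *m P *m b^ct = P by rewrite bP -[in LHS]PH -ctrM bP.
split.
  by rewrite X1E YE ZE -[in LHS]bPb -mulmxDl -mulmxDr -/P !mulmxA.
rewrite ctrM ctrK -mulmxA lX -/P -{1}PM !mulmxA; congr (_ *m _ *m _).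
by rewrite mulmxBr mulmxBl mulmx1 mul1mx -[in LHS]PH -[in RHS]PH -!ctrM Pb bP.
Qed.
End Hermitian.

(** * Lagrangians and real points *)

Section RowBase.
Variables (K : fieldType).

Lemma row_base_rank p m (A : 'M[K]_(p, m)) r :
  \rank A = r -> exists B : 'M[K]_(r, m), (B == A)%MS.
Proof. by move=> <-; exists (row_base A); apply/eqmxP; apply: eq_row_base. Qed.

End RowBase.

Section ComplexPoints.
Variables (R : realType) (n : nat).
Local Notation C := (R[i]).
Local Notation M2 := 'M[C]_(n + n).
Local Notation Pt := 'M[C]_(n + n, n).
Local Notation "A ^ct" := (ctr Num.conj A) (at level 2, format "A ^ct").
Local Notation cj := (map_mx (Num.conj : C -> C)).
Local Notation J := (@J_B R n).
Local Notation V := (@V0 R n).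
Implicit Types (X Y : Pt) (g h : M2).

Let cK : involutive (Num.conj : C -> C) := @conjCK _.

Lemma span_eqP X Y :
  span_eq X Y <-> exists2 u, u \in unitmx & X = Y *m u.
Proof.
rewrite /span_eq; split=> [/eqmxMunitP[u u_unit XE]|[u u_unit ->]].
  by exists u^T; rewrite ?unitmx_tr // -[X]trmxK XE trmx_mul trmxK.
by apply/eqmxMunitP; exists u^T; rewrite ?unitmx_tr // trmx_mul.
Qed.

Lemma span_eq_refl X : span_eq X X.
Proof. by rewrite /span_eq !submx_refl. Qed.

Lemma span_eq_sym X Y : span_eq X Y -> span_eq Y X.
Proof. by rewrite /span_eq andbC. Qed.

Lemma span_eq_trans X Y Z : span_eq X Y -> span_eq Y Z -> span_eq X Z.
Proof.
case/span_eqP=> u u_unit -> /span_eqP[v v_unit ->].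
by apply/span_eqP; exists (v *m u); rewrite ?unitmx_mul ?u_unit ?v_unit ?mulmxA.
Qed.

Lemma span_eq_mull g X Y : span_eq X Y -> span_eq (g *m X) (g *m Y).
Proof.
by case/span_eqP=> u u_unit ->; apply/span_eqP; exists u; rewrite ?mulmxA.
Qed.

Lemma span_eq_cj X Y : span_eq X Y -> span_eq (cj X) (cj Y).
Proof.
case/span_eqP=> u u_unit ->; apply/span_eqP.
by exists (cj u); rewrite ?map_unitmx ?map_mxM.
Qed.

Lemma span_eq_rank X Y : span_eq X Y -> \rank X = \rank Y.
Proof.
by case/span_eqP=> u u_unit ->; rewrite mxrankMfree ?row_free_unit.
Qed.

Lemma rank_mul_unit m (g : 'M[C]_m) p (X : 'M[C]_(m, p)) :
  g \in unitmx -> \rank (g *m X) = \rank X.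
Proof.
by move=> g_unit; rewrite eqmxMfull // row_full_unit.
Qed.

Lemma rank_V0 : \rank V = n.
Proof. by rewrite -mxrank_tr tr_col_mx trmx1 trmx0 rank_row_mx0 mxrank1. Qed.

Lemma J_sq : J *m J = - 1%:M.
Proof.
rewrite mulmx_block !mul0mx !mulmx0 !mul1mx !mulmx1 !addr0 !add0r.
by rewrite [in RHS]scalar_mx_block opp_block_mx !oppr0.
Qed.

Lemma J_cj : cj J = J.
Proof. by rewrite map_block_mx map_mxN map_mx1 !map_mx0. Qed.

Lemma J_tr : J^T = - J.
Proof.
by rewrite tr_block_mx linearN /= !trmx0 trmx1 opp_block_mx !oppr0 opprK.
Qed.

Lemma J_ct : J^ct = - J.
Proof. by rewrite /ctr J_cj J_tr. Qed.

Lemma J_unit : J \in unitmx.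
Proof.
have /mulmx1_unit[] // : J *m - J = 1%:M by rewrite mulmxN J_sq opprK.
Qed.

Lemma J_AE : @J_A R n = 'i *: J. Proof. by []. Qed.

(** As [J_A] is ['i] times [J], this is isotropy for the Hermitian form of Case (A). For a real [X]
    it is also isotropy for the symplectic form, so one notion serves both cases. *)
Definition isotropic X : Prop := X^ct *m J *m X = 0.
Definition lagr X : Prop := \rank X = n /\ isotropic X.

Lemma isotropic_col (X1 X2 : 'M[C]_n) :
  isotropic (col_mx X1 X2) <-> X1^ct *m X2 = X2^ct *m X1.
Proof.
rewrite /isotropic /ctr map_col_mx tr_col_mx -!/(ctr _ _) mul_row_block.
rewrite !mulmx0 addr0 add0r mulmxN !mulmx1 mul_row_col mulNmx addrC.
by split=> [/eqP|->]; rewrite ?subrr // subr_eq0 => /eqP.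
Qed.

Lemma lagr_span X Y : span_eq X Y -> lagr Y -> lagr X.
Proof.
move=> XY [rkY isoY]; split; first by rewrite (span_eq_rank XY).
case/span_eqP: XY => u _ ->; rewrite /isotropic ctrM -!mulmxA.
by rewrite (mulmxA J) (mulmxA Y^ct) (mulmxA Y^ct) isoY mul0mx mulmx0.
Qed.

(** Positive definiteness: a row vector [v] in the kernel makes [v X^*] a vector of norm zero. *)
Lemma gram_unit m p (X : 'M[C]_(m, p)) : \rank X = p -> X^ct *m X \in unitmx.
Proof.
move=> rkX; rewrite -row_free_unit -kermx_eq0; apply/rowV0P=> v /sub_kermxP vX.
have w0 : v *m X^ct = 0.
  have : (v *m X^ct) *m (v *m X^ct)^ct = 0.
    by rewrite ctrM (ctrK cK) mulmxA -(mulmxA v) vX mul0mx.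
  move/matrixP=> /(_ ord0 ord0); rewrite !mxE => /eqP.
  rewrite psumr_eq0 => [|i _]; last by rewrite !mxE mul_conjC_ge0.
  move=> /allP w0; apply/rowP=> i; have := w0 i (mem_index_enum _).
  by rewrite /= [(_ ^ct) _ _]ctrE mul_conjC_eq0 => /eqP ->; rewrite mxE.
have freeX : row_free X^ct by rewrite /row_free mxrank_tr mxrank_map rkX.
by apply: (row_free_inj freeX); rewrite w0 mul0mx.
Qed.

(* The transverse Lagrangian [J X] completes a basis of [X] to a unitary
   frame, up to the Gram matrix of [X]. *)
Lemma lagr_frame X : lagr X -> exists g,
  [/\ g^ct *m J *m g = J, X = g *m V & cj X = X -> cj g = g].
Proof.
case=> rkX isoX; have GX := gram_unit rkX; pose S := invmx (X^ct *m X).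
have SH : S^ct = S by rewrite ctrV ctrM (ctrK cK).
pose Y := - (J *m X *m S).
have Yct : Y^ct = S *m X^ct *m J.
  by rewrite /Y /ctr map_mxN linearN /= -/(ctr _ _) !ctrM SH J_ct mulmxA mulmxN opprK.
exists (row_mx X Y); split; last 1 first.
- move=> Xr; rewrite map_row_mx Xr map_mxN !map_mxM J_cj Xr; congr (row_mx _ (- _)).
  rewrite /S map_invmx map_mxM Xr; congr (_ *m invmx (_ *m _)).
  by rewrite /ctr Xr -map_trmx Xr.
- have XJY : X^ct *m J *m Y = 1%:M.
    rewrite mulmxN !mulmxA -(mulmxA _ J J) J_sq mulmxN mulmx1 !mulNmx opprK.
    exact: mulmxV.
  have YJX : Y^ct *m J *m X = - 1%:M.
    rewrite Yct -!mulmxA (mulmxA J) J_sq mulNmx mul1mx !mulmxN.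
    by rewrite mulVmx.
  have YJY : Y^ct *m J *m Y = 0.
    rewrite mulmxN !mulmxA Yct -(mulmxA _ J J) J_sq mulmxN mulmx1 !mulNmx.
    by rewrite -!(mulmxA S) isoX mul0mx mulmx0 !oppr0.
  rewrite /ctr map_row_mx tr_row_mx -!/(ctr _ _) mul_col_mx mul_col_row.
  by rewrite isoX XJY YJX YJY.
- by rewrite mul_row_col mulmx1 mulmx0 addr0.
Qed.

Lemma isotropic_V0 : isotropic V.
Proof.
by rewrite /V0; apply/isotropic_col; rewrite /ctr map_mx0 trmx0 mulmx0 mul0mx.
Qed.

Lemma isometry_unit g : g^ct *m J *m g = J -> g \in unitmx.
Proof. by move=> gJ; have := J_unit; rewrite -gJ unitmx_mul => /andP[_]. Qed.

Lemma isometry_lagr g : g^ct *m J *m g = J -> lagr (g *m V).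
Proof.
move=> gJ; split; first by rewrite rank_mul_unit ?rank_V0 // isometry_unit.
rewrite /isotropic ctrM -!mulmxA (mulmxA J) (mulmxA g^ct) (mulmxA g^ct) gJ.
by rewrite mulmxA isotropic_V0.
Qed.

Lemma G_A_isometry g : G_A g <-> g^ct *m J *m g = J.
Proof.
have i0 : ('i : C) != 0 by apply: neq0Ci.
rewrite /G_A J_AE -scalemxAr -scalemxAl.
by split=> [/(scalerI i0)|gJ] //; congr (_ *: _).
Qed.

Lemma GP_A_lagr X : GP_A X <-> lagr X.
Proof.
split=> [[g /G_A_isometry gJ XE] | lX].
  by apply: lagr_span XE _; apply: isometry_lagr.
have [g [gJ XE _]] := lagr_frame lX.
by exists g; [apply/G_A_isometry | rewrite -XE; apply: span_eq_refl].
Qed.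

Lemma gamma_A_isometry g : g^ct *m J *m g = J -> gamma_A g = g.
Proof.
move=> gJ; have g_unit := isometry_unit gJ.
rewrite /gamma_A /adj -/(ctr _ _) J_AE invmxZ ?J_unit //; last first.
  by rewrite unitmxZ ?J_unit // unitfE neq0Ci.
rewrite -scalemxAr -!scalemxAl scalerA mulfV ?neq0Ci // scale1r.
have gct : g^ct \in unitmx by rewrite ctr_unit.
rewrite -[X in _ *m X = _]gJ -!mulmxA mulKmx //.
by rewrite mulKmx ?J_unit.
Qed.

(** Since [g^* J_A gamma(g) = J_A] and [V] is isotropic, [gamma(g) V] is orthogonal to [g V]; when
    both span [X], the point is isotropic. Conversely a Lagrangian has an isometric frame, and
    isometries are fixed by [gamma_A]. *)
Lemma real_A_lagr X : real_A X <-> lagr X.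
Proof.
split=> [[g [g_unit XE gX]] | lX].
  split; first by rewrite (span_eq_rank XE) rank_mul_unit // rank_V0.
  have i0 : ('i : C) != 0 by apply: neq0Ci.
  case/span_eqP: XE => u _ XE; case/span_eqP: (span_eq_sym gX) => v _ XE'.
  have JA_unit : @J_A R n \in unitmx by rewrite unitmxZ ?unitfE // J_unit.
  have gct : adj g \in unitmx by rewrite [_ \in _]ctr_unit.
  apply: (scalerI i0); rewrite scaler0 scalemxAl scalemxAr -J_AE.
  rewrite {2}XE' XE ctrM ctrM /gamma_A -!mulmxA mulKVmx // mulKVmx //.
  rewrite J_AE -!scalemxAl -!scalemxAr.
  rewrite (mulmxA J) (mulmxA V^ct) (mulmxA V^ct) isotropic_V0.
  by rewrite mul0mx mulmx0 scaler0.
have [g [gJ XE _]] := lagr_frame lX.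
exists g; rewrite gamma_A_isometry // -XE isometry_unit //.
by split=> //; apply: span_eq_refl.
Qed.

Lemma real_mxP m p (A : 'M[C]_(m, p)) : real_mx A <-> cj A = A.
Proof.
split=> [Ar|Ar i j]; first by apply/matrixP=> i j; rewrite mxE; apply/CrealP.
by apply/CrealP; rewrite -[in RHS]Ar mxE.
Qed.

Local Notation rc := (map_mx (real_complex R)).

Lemma cj_rc m p (A : 'M[R]_(m, p)) : cj (rc A) = rc A.
Proof. by apply/matrixP=> i j; rewrite !mxE; apply/conjc_real. Qed.

Lemma real_mx_rc m p (A : 'M[C]_(m, p)) : cj A = A -> exists B, A = rc B.
Proof.
move=> Ar; exists (map_mx (fun z : C => complex.Re z) A).
apply/matrixP=> i j; rewrite !mxE; have := congr1 (fun B : 'M_(m, p) => B i j) Ar.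
rewrite mxE; case: (A i j) => x y /= [/eqP].
by rewrite eq_sym -addr_eq0 -mulr2n mulrn_eq0 /= => /eqP ->.
Qed.

(* The orthogonal projector onto a subspace is defined over the reals as soon
   as the subspace is. *)
Lemma real_span X : \rank X = n -> span_eq (cj X) X ->
  exists X0 : 'M[R]_(n + n, n), span_eq X (rc X0).
Proof.
move=> rkX /span_eqP[u u_unit XE]; have GX := gram_unit rkX.
pose S := invmx (X^ct *m X); pose P := X *m S *m X^ct.
have PX : P *m X = X by rewrite /P -!mulmxA mulVmx // mulmx1.
have PH : P^ct = P by rewrite /P !ctrM (ctrK cK) ctrV ctrM (ctrK cK) mulmxA.
(* [P] and [cj P] are Hermitian projectors with the same image. Each absorbs the other, and taking
   adjoints gives equality. *)
have Pr : cj P = P.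
  have PcX : cj P *m cj X = cj X by rewrite -map_mxM PX.
  have PcP : cj P *m P = P.
    have PcX' : cj P *m X = X.
      by apply: (can_inj (mulmxK u_unit)); rewrite -mulmxA -XE PcX.
    by rewrite {2}/P !mulmxA PcX'.
  have PPc : P *m cj P = cj P.
    have -> : cj P = cj X *m (cj S *m cj X^ct) by rewrite /P !map_mxM mulmxA.
    by rewrite mulmxA XE !(mulmxA P) PX.
  have PcH : (cj P)^ct = cj P by rewrite -[in RHS]PH /ctr map_trmx.
  by rewrite -[LHS]PcH -[in LHS]PPc ctrM PcH PH PcP.
have [P0 PE] := real_mx_rc Pr.
have rkP : \rank P0^T = n.
  rewrite mxrank_tr -(mxrank_map (real_complex R)) -PE.
  have le1 : (\rank P <= \rank X)%N by rewrite /P -mulmxA mxrankM_maxl.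
  have le2 : (\rank X <= \rank P)%N by rewrite -{1}PX mxrankM_maxl.
  by rewrite -[RHS]rkX; apply/eqP; rewrite eqn_leq le1.
have [B BE] := row_base_rank rkP.
exists B^T; rewrite /span_eq map_trmx trmxK.
have {BE} : (rc B == P^T)%MS by rewrite PE map_trmx !map_submx.
case/andP=> sBP sPB; apply/andP; split.
  by apply: submx_trans sPB; rewrite -{1}PX trmx_mul submxMl.
by apply: (submx_trans sBP); rewrite /P -mulmxA trmx_mul submxMl.
Qed.

Definition lagr_real X : Prop :=
  exists X0 : 'M[R]_(n + n, n), lagr (rc X0) /\ span_eq X (rc X0).

Lemma real_span_lagr X :
    \rank X = n -> X^T *m J *m X = 0 -> span_eq (cj X) X -> lagr_real X.
Proof.
move=> rkX isoX cX; have [X0 XX0] := real_span rkX cX.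
exists X0; split=> //; split; first by rewrite -(span_eq_rank XX0).
rewrite /isotropic /ctr cj_rc; case/span_eqP: (span_eq_sym XX0) => u _ ->.
rewrite trmx_mul -!mulmxA (mulmxA J) (mulmxA X^T) (mulmxA X^T) isoX.
by rewrite mul0mx mulmx0.
Qed.

Lemma lagr_real_lagr X : lagr_real X -> lagr X.
Proof. by case=> X0 [lX XE]; apply: lagr_span lX. Qed.

Lemma real_B_cj X : real_B X -> span_eq (cj X) X.
Proof.
case=> g [_ XE gX]; apply: span_eq_trans (span_eq_cj XE) _.
by rewrite map_mxM map_col_mx map_mx1 map_mx0; apply: gX.
Qed.

Lemma real_B_lagr X : real_B X -> lagr_real X.
Proof.
move=> Xr; have cX := real_B_cj Xr; case: Xr => g [gJ XE gX].
have g_unit : g \in unitmx by have := J_unit; rewrite -gJ unitmx_mul => /andP[].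
have rkX : \rank X = n by rewrite (span_eq_rank XE) rank_mul_unit ?rank_V0.
apply: real_span_lagr => //; have /span_eqP[u _ ->] := XE.
rewrite !trmx_mul -!mulmxA (mulmxA J) (mulmxA g^T) (mulmxA g^T) gJ.
have VJ : V^T *m J *m V = 0.
  by rewrite -[RHS]isotropic_V0 /ctr map_col_mx map_mx1 map_mx0.
by rewrite (mulmxA J) (mulmxA V^T) (mulmxA V^T) VJ mul0mx mulmx0.
Qed.

Lemma lagr_real_GP_B X : lagr_real X -> GP_B X.
Proof.
case=> X0 [lX XE]; have [g [gJ X0E gr]] := lagr_frame lX.
have {}gr := gr (cj_rc X0).
exists g; last by rewrite -X0E.
by split; [rewrite /Sp_C -[in RHS]gJ /ctr gr | apply/real_mxP].
Qed.

Lemma GP_B_real_B X : GP_B X -> real_B X.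
Proof.
case=> g [gJ /real_mxP gr] XE; exists g; split=> //.
by rewrite /gamma_B gr; apply: span_eq_sym.
Qed.

End ComplexPoints.

(** * Partial permutations and their orbits *)

Section PartialPermutations.
Variables (R : realType) (n : nat).
Local Notation C := (R[i]).
Local Notation intC := (map_mx (fun z : int => z%:~R : C)).
Local Notation tmat := 'M[int]_(n + n, n).
Local Notation Pt := 'M[C]_(n + n, n).
Implicit Types (t : tmat) (T : 'M[int]_n) (e A : {set 'I_n}).

Lemma intr_bool (b : bool) : ((b%:R : int)%:~R : C) = b%:R.
Proof. by case: b. Qed.

Lemma bool_eq1 (b : bool) : (b%:R : int) = 1 -> b.
Proof. by case: b. Qed.

Lemma is_pp_neq0 T i j : is_pp T -> T i j != 0 -> T i j = 1.
Proof. by case=> T01 _ _; case: (T01 i j) => ->. Qed.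

Lemma tauCE t : tauC R t = col_mx (intC (tau1 t)) (intC (tau2 t)).
Proof. by rewrite -map_col_mx vsubmxK. Qed.

Definition sign_mx e : 'M[C]_n := diag_mx (\row_j (if j \in e then -1 else 1)).

Definition signed_pt t e : Pt :=
  col_mx (intC (tau1 t) *m sign_mx e) (intC (tau2 t)).

Lemma mul_signE m (M : 'M[C]_(m, n)) e i j :
  (M *m sign_mx e) i j = M i j * (if j \in e then -1 else 1).
Proof. by rewrite mul_mx_diag !mxE. Qed.

(** Take for [tau_1] the support of [P + Q], for [tau_2] the projector [1 - P], and for [e] the
    positions of the diagonal entries -1. The columns in [e] then agree in both blocks. *)
Lemma spp_signed_pt A (Q : 'M[int]_n) :
    spp Q -> (forall i j, i \notin A -> Q i j = 0) ->
  exists t e, [/\ inR R t, e \subset Dset t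
    & signed_pt t e = col_mx (coproj C A + intC Q) (1%:M - coproj C A)].
Proof.
move=> sQ QA; have [_ Qfun Qval Qneg] := sQ.
pose t1 : 'M[int]_n :=
  \matrix_(i, j) ((i == j) && (i \notin A) || (Q i j != 0))%:R.
pose t2 : 'M[int]_n := diag_mx (\row_i (i \in A)%:R).
pose t := col_mx t1 t2.
have t1E : tau1 t = t1 by rewrite /tau1 col_mxKu.
have t2E : tau2 t = t2 by rewrite /tau2 col_mxKd.
have t1sym i j : t1 i j = t1 j i.
  by rewrite !mxE (spp_sym _ _ sQ) eq_sym; case: eqP => // ->.
have t2ij i j : t2 i j = ((i == j) && (i \in A))%:R.
  rewrite !mxE eq_sym; case: eqP => //= ->; by rewrite mulr1n.
have t1row i j j' : t1 i j = 1 -> t1 i j' = 1 -> j = j'.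
  rewrite !mxE => /bool_eq1 ij /bool_eq1 ij'; move: ij ij'.
  have [Ai|Ai] := boolP (i \in A); first by rewrite !andbF /=; apply: Qfun.
  by rewrite !QA // !eqxx !orbF !andbT => /eqP<- /eqP.
pose e := [set j | Q j j == -1].
have QjA j i : Q i j != 0 -> j \in A.
  by apply: contraNT => Aj; rewrite (spp_sym _ _ sQ) QA.
have P1E i j : coproj C A i j = ((i == j) && (i \notin A))%:R.
  rewrite !mxE eq_sym; case: eqP => //= ->; by rewrite mulr1n.
have T1ij i j : intC t1 i j = ((i == j) && (i \notin A) || (Q i j != 0))%:R.
  by rewrite 2!mxE intr_bool.
have T2E : intC t2 = 1%:M - coproj C A.
  apply/matrixP=> i j; rewrite mxE t2ij intr_bool !mxE.
  case: eqP => [->|]; rewrite /= ?subr0 //.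
  by case: (j \in A); rewrite /= ?subr0 ?subrr.
exists t, e; split; last 1 first.
- rewrite /signed_pt t1E t2E T2E; congr col_mx.
  apply/matrixP=> i j; rewrite mul_signE T1ij mxE P1E mxE inE.
  case: (Qval i j) => Qij; rewrite Qij.
  + rewrite eqxx orbF addr0; case: (eqVneq i j) => /= [eij|_].
      by rewrite -eij in Qij *; rewrite Qij mulr1.
    by rewrite mul0r.
  + have iA : i \in A by apply: contraT => /QA-/(_ j); rewrite Qij.
    rewrite iA andbF add0r /= mul1r; case: eqP => // Qjj.
    have eij : i = j by apply: (Qfun j); rewrite ?Qjj // spp_sym // Qij.
    by move: Qij; rewrite eij Qjj.
  + have eij := Qneg _ _ Qij.
    have iA : i \in A by apply: contraT => /QA-/(_ j); rewrite Qij.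
    by rewrite -eij in Qij *; rewrite Qij iA andbF add0r /= mul1r.
- split; [split|].
  + rewrite t1E; split=> // [i j|i i' j].
      by rewrite mxE; case: (_ || _); [right|left].
    by rewrite (t1sym i) (t1sym i'); apply: t1row.
  + rewrite t2E; split=> [i j|i j j'|i i' j]; rewrite !t2ij.
    * by case: (_ && _); [right|left].
    * by move=> /bool_eq1/andP[/eqP<- _] /bool_eq1/andP[/eqP].
    * by move=> /bool_eq1/andP[/eqP-> _] /bool_eq1/andP[/eqP].
  + rewrite tauCE t1E t2E; apply/eqP; rewrite eqn_leq rank_leq_col /=.
    (* The rank is [n] because [(P, 1 - P)] is a left inverse of tau: [P] kills the support of
       [Q]. *)
    have E : row_mx (coproj C A) (1%:M - coproj C A) *m
             col_mx (intC t1) (intC t2) = 1%:M.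
      apply/matrixP=> i j; rewrite mul_row_col mxE coproj_mulE subcoprojE T1ij.
      rewrite mxE t2ij intr_bool mxE -!natrM -natrD.
      have [Ai|Ai] := boolP (i \in A); first by rewrite mul0n add0n mul1n andbT.
      by rewrite QA // eqxx orbF andbT mul1n mul0n addn0.
    rewrite -{1}(mxrank1 C n) -[in X in (X <= _)%N]E.
    exact: mxrankM_maxr.
  + rewrite t1E t2E; apply/matrixP=> i j; rewrite mxE.
    have E k l : (t1^T *m t2) k l = (Q k l != 0)%:R.
      rewrite mul_mx_diag !mxE -natrM mulnb (spp_sym l k sQ); congr _%:R.
      case: (boolP (l \in A)) => [Al|Al]; first by rewrite andbF andbT.
      by rewrite (spp_sym k l sQ) QA // eqxx !andbF.
    by rewrite !E (spp_sym _ _ sQ).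
- apply/subsetP=> j; rewrite !inE => /eqP Qjj; rewrite t1E t2E.
  apply/eqP/colP=> k; rewrite mxE [RHS]mxE t2ij mxE; congr (nat_of_bool _)%:R.
  have Aj : j \in A by apply: (@QjA j j); rewrite Qjj.
  case: (eqVneq k j) => [->|nkj] /=; first by rewrite Qjj Aj.
  apply/negbTE; apply: contra nkj => Qkj; apply/eqP; apply: (Qfun j).
    by rewrite spp_sym.
  by rewrite Qjj.
Qed.


Lemma tau1_col_perm s t : tau1 (col_perm s t) = col_perm s (tau1 t).
Proof. by apply/matrixP=> i j; rewrite !mxE. Qed.

Lemma tau2_col_perm s t : tau2 (col_perm s t) = col_perm s (tau2 t).
Proof. by apply/matrixP=> i j; rewrite !mxE. Qed.

Lemma signed_pt_col_perm s t e :
  span_eq (signed_pt (col_perm s t) e) (signed_pt t (s @: e)).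
Proof.
apply/span_eqP; exists (perm_mx s^-1); first exact: unitmx_perm.
rewrite mul_col_mx -!col_permE /signed_pt tau1_col_perm tau2_col_perm.
congr col_mx; apply/matrixP=> i j; last by rewrite !mxE.
rewrite [RHS]mxE !mul_signE (mem_imset e j (@perm_inj _ s)); congr (_ * _).
by rewrite !mxE.
Qed.

Lemma Dset_col_perm s t e :
  e \subset Dset (col_perm s t) -> s @: e \subset Dset t.
Proof.
move=> /subsetP sD; apply/subsetP=> _ /imsetP[j je ->].
have := sD j je; rewrite !inE tau1_col_perm tau2_col_perm.
move=> /eqP/colP E; apply/eqP/colP=> i.
by have := E i; rewrite !mxE.
Qed.

(** Two equal columns cannot both vanish, for tau would then have a zero column, against its
    rank. *)
Lemma inT_row t j : inT R t -> j \in Dset t ->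
  exists i, tau1 t i j = 1 /\ tau2 t i j = 1.
Proof.
case=> pp1 pp2 rk; rewrite inE => /eqP/colP E.
have {}E i : tau1 t i j = tau2 t i j by have := E i; rewrite !mxE.
have [/existsP[i ti]|/existsPn t0] := boolP [exists i, tau1 t i j != 0].
  by exists i; rewrite -E (is_pp_neq0 pp1).
have free : row_free (tauC R t)^T by rewrite /row_free mxrank_tr rk.
have : (delta_mx ord0 j : 'rV[C]_n) = 0.
  apply: (row_free_inj free); rewrite mul0mx -trmx_delta -trmx_mul tauCE.
  have T1j : tau1 t *m delta_mx j ord0 = 0 :> 'cV_n.
    rewrite -colE; apply/colP=> i; have /negPn/eqP t0i := t0 i.
    by rewrite [LHS]mxE t0i mxE.
  have T2j : tau2 t *m delta_mx j ord0 = 0 :> 'cV_n.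
    by rewrite -T1j -!colE; apply/colP=> i; rewrite [LHS]mxE [RHS]mxE E.
  rewrite mul_col_mx -(map_delta_mx (intmul 1 : {rmorphism int -> C})).
  by rewrite -!(map_mxM (intmul 1 : {rmorphism int -> C})) T1j T2j !map_mx0
     col_mx0 trmx0.
by move/rowP/(_ j); rewrite !mxE !eqxx => /eqP; rewrite oner_eq0.
Qed.

(** The rows met by the columns of [e] are scaled by ['i] above and by its inverse below, and the
    columns in [e] by ['i]. The net factors are -1 above and 1 below. The matrix lies in the Borel
    subgroup of Case (B), hence also in that of Case (A). *)
Lemma signed_pt_orbit t e : inT R t -> e \subset Dset t ->
  Borbit (@BHC_B R n) t (signed_pt t e).
Proof.
move=> tT; have [[T01 T1r _] [_ T2r _] _] := tT; move=> /subsetP sD.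
pose al i : C := if [exists j in e, tau1 t i j == 1] then 'i else 1.
pose a : 'M[C]_n := diag_mx (\row_i al i).
pose w : 'M[C]_n := diag_mx (\row_j (if j \in e then 'i else 1)).
have aE m (M : 'M_(n, m)) i j : (a *m M) i j = al i * M i j.
  by rewrite mul_diag_mx !mxE.
have wE m (M : 'M_(m, n)) i j :
  (M *m w) i j = M i j * (if j \in e then 'i else 1).
  by rewrite mul_mx_diag !mxE.
have al0 i : al i != 0 by rewrite /al; case: ifP; rewrite ?neq0Ci ?oner_eq0.
have diag_upper (d : 'rV[C]_n) : upper_mx (diag_mx d).
  by move=> i j ltji; rewrite mxE -val_eqE /= gtn_eqF.
have a_unit : a \in unitmx.
  by apply: upper_mx_unit (diag_upper _) _ => i; rewrite !mxE eqxx mulr1n.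
have w_unit : w \in unitmx.
  apply: upper_mx_unit (diag_upper _) _ => i; rewrite !mxE eqxx mulr1n.
  by case: ifP; rewrite ?neq0Ci ?oner_eq0.
have De j : j \in e -> forall i, tau1 t i j = tau2 t i j.
  by move=> /sD; rewrite inE => /eqP/colP E i; have := E i; rewrite !mxE.
exists (block_mx a 0 0 (invmx a^T)).
  by exists a; split=> //; apply: diag_upper.
apply/span_eqP; exists w => //.
rewrite tauCE mul_block_col !mul0mx addr0 add0r mul_col_mx tr_diag_mx.
congr col_mx; last first.
  apply: (can_inj (mulKmx a_unit)); rewrite mulmxA mulKVmx //.
  apply/matrixP=> i j; rewrite aE wE ![intC _ _ _]mxE.
  case: (eqVneq (tau2 t i j) 0) => [->|nz]; first by rewrite mulr0 mul0r.
  rewrite mulrC; congr (_ * _); rewrite /al.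
  have t2 : tau2 t i j = 1 by apply: is_pp_neq0 nz; case: tT.
  have [je|jNe] := boolP (j \in e).
    by case: existsP => // -[]; exists j; rewrite je De // t2 eqxx.
  case: existsP => // -[j' /andP[j'e /eqP t1]].
  rewrite De // in t1; have := T2r _ _ _ t2 t1 => ejj'.
  by rewrite ejj' j'e in jNe.
apply/matrixP=> i j; rewrite wE aE mul_signE ![intC _ _ _]mxE.
case: (T01 i j) => t1; rewrite t1 ?mulr0 ?mul0r // mul1r mulr1 /al.
have [je|jNe] := boolP (j \in e).
  case: existsP => [_|[]]; first by rewrite -expr2 sqrCi.
  by exists j; rewrite je t1 eqxx.
case: existsP => [[j' /andP[j'e /eqP t1']]|]; last by rewrite mulr1.
by rewrite (T1r _ _ _ t1 t1') j'e in jNe.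
Qed.

(* The total weight of the nonzero rows of column [j]: as [f] is injective and
   positive, it determines a column of a partial permutation matrix. *)
Definition wt (f : 'I_n -> nat) T j : nat :=
  \sum_i (if T i j == 1 then f i else 0%N).

Lemma wt1 f T i j : is_pp T -> T i j = 1 -> wt f T j = f i.
Proof.
case=> _ _ Tc Tij; rewrite /wt (bigD1 i) //= Tij eqxx big1 ?addn0 // => k nki.
by case: eqP => // Tkj; rewrite (Tc k i j) ?eqxx in nki.
Qed.

Lemma wt0 f T j : (forall i, T i j = 0) -> wt f T j = 0%N.
Proof. by move=> T0; rewrite /wt big1 // => i _; rewrite T0. Qed.

Lemma is_pp_colP T j : is_pp T ->
  (exists i, T i j = 1) \/ (forall i, T i j = 0).
Proof.
move=> pp; have [/existsP[i ti]|/existsPn t0] := boolP [exists i, T i j != 0].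
  by left; exists i; apply: is_pp_neq0.
by right=> i; apply/eqP; have := t0 i; rewrite negbK.
Qed.

Lemma wt_inj f T T' j k : injective f -> (forall i, 0 < f i)%N ->
  is_pp T -> is_pp T' -> wt f T j = wt f T' k -> forall i, T i j = T' i k.
Proof.
move=> f_inj f0 pp pp'.
have one (U : 'M[int]_n) i l x : is_pp U -> U i l = 1 -> U x l = (x == i)%:R.
  move=> ppU Ui; have [U01 _ Uc] := ppU; case: eqP => [->//|nxi].
  by case: (U01 x l) => // Ux; case: nxi; apply: Uc Ux Ui.
have [[i Ti]|T0] := is_pp_colP j pp; have [[i' Ti']|T0'] := is_pp_colP k pp'.
- by rewrite (wt1 f pp Ti) (wt1 f pp' Ti') => /f_inj eii x;
     rewrite (one _ _ _ _ pp Ti) (one _ _ _ _ pp' Ti') eii.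
- by rewrite (wt1 f pp Ti) (wt0 f T0') => fi; have := f0 i; rewrite fi.
- by rewrite (wt0 f T0) (wt1 f pp' Ti') => fi; have := f0 i'; rewrite -fi.
- by move=> _ x; rewrite T0 T0'.
Qed.

(** If the 1 of column [j] of [T'] is in row [i], then the entry [(i, k)] of [T' u] is [u j k]. As
    it is nonzero, column [k] of [T] has its 1 in some row [l] with [a i l] nonzero. *)
Lemma wt_mono f (a u : 'M[C]_n) T T' j k : is_pp T -> is_pp T' ->
    (forall i l, a i l != 0 -> (f i <= f l)%N) ->
    a *m intC T = intC T' *m u -> u j k != 0 ->
  (wt f T' j <= wt f T k)%N.
Proof.
move=> pp pp' amono aT ujk.
have [[i Ti]|T0] := is_pp_colP j pp'; last by rewrite (wt0 f T0).
have : (a *m intC T) i k != 0.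
  rewrite aT mxE (bigD1 j) //= mxE Ti mul1r big1 ?addr0 // => l nlj.
  have [T01 Tr _] := pp'; rewrite mxE; case: (T01 i l) => Til.
    by rewrite Til mul0r.
  by rewrite (Tr _ _ _ Til Ti) eqxx in nlj.
rewrite (wt1 f pp' Ti) mxE => nz.
have [l /andP[ail Tlk]] : exists l, (a i l != 0) && (T l k == 1).
  apply/existsP; apply: contraNT nz => /existsPn all0; apply/eqP.
  apply: big1 => l _; rewrite mxE; have := all0 l; rewrite negb_and negbK.
  case/orP=> [/eqP->|Tlk]; first by rewrite mul0r.
  have [T01 _ _] := pp; case: (T01 l k) => Tl; rewrite Tl ?mulr0 //.
  by rewrite Tl eqxx in Tlk.
by rewrite (wt1 f pp (eqP Tlk)); apply: amono.
Qed.

(* Leibniz formula: some term of the determinant is nonzero. *)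
Lemma unitmx_perm_support (u : 'M[C]_n) :
  u \in unitmx -> exists s : 'S_n, forall j, u j (s j) != 0.
Proof.
rewrite unitmxE unitfE => det_nz.
have [/existsP[s /forallP us]|/existsPn none] :=
    boolP [exists s : 'S_n, [forall j, u j (s j) != 0]].
  by exists s.
case/eqP: det_nz; apply: big1 => s _; apply/eqP.
have := none s; rewrite negb_forall => /existsP[j]; rewrite negbK => /eqP uj.
by rewrite (bigD1 j) //= uj mul0r mulr0.
Qed.

(** The weights [i.+1] and [n - i] follow the upper and the lower triangular factor; both are
    positive, so a zero column has strictly smaller weight than any other. Both blocks share [u],
    hence the same permutation serves both. *)
Lemma BHC_orbit_wt t t' b : inT R t -> inT R t' -> BHC_A b ->
    span_eq (b *m tauC R t) (tauC R t') ->
  exists s : 'S_n, forall j,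
    (wt (fun i => i.+1) (tau1 t') j <= wt (fun i => i.+1) (tau1 t) (s j))%N /\
    (wt (fun i => n - i)%N (tau2 t') j <= wt (fun i => n - i)%N (tau2 t) (s j))%N.
Proof.
move=> [pp1 pp2 _] [pp1' pp2' _] [a1 [a2 [_ ua1 _ la2 ->]]].
case/span_eqP=> u /unitmx_perm_support[s us].
rewrite !tauCE mul_block_col !mul0mx addr0 add0r mul_col_mx.
move=> /eq_col_mx[aT1 aT2]; exists s => j; split.
  apply: wt_mono pp1 pp1' _ aT1 (us j) => i l; apply: contraNT.
  by rewrite -ltnNge ltnS => /ua1->.
apply: wt_mono pp2 pp2' _ aT2 (us j) => i l; apply: contraNT => ltil.
rewrite la2 //; rewrite ltnNge; apply: contra ltil => le_li.
exact: leq_sub2l.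
Qed.

Lemma perm_sum_eq (w w' : 'I_n -> nat) (p p' : 'S_n) :
    (forall j, w' j <= w (p j))%N -> (forall j, w j <= w' (p' j))%N ->
  forall j, w' j = w (p j).
Proof.
move=> le1 le2 j; have le1' k : (w' k <= w (p k) ?= iff (w' k == w (p k)))%N.
  exact: leqif_eq.
have [le eq] := leqif_sum (fun k (_ : true) => le1' k).
have : (\sum_k w' k == \sum_k w (p k))%N.
  rewrite eqn_leq le.
  have -> : (\sum_k w (p k) = \sum_k w k)%N.
    by rewrite [RHS](reindex_inj (@perm_inj _ p)).
  rewrite [X in (_ <= X)%N](reindex_inj (@perm_inj _ p')).
  by apply: leq_sum.
by rewrite eq => /forall_inP/(_ j isT)/eqP.
Qed.

(* Applying [BHC_orbit_wt] in both directions, the sums of the weights force all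
   the inequalities to be equalities. *)
Lemma BHC_orbit_col_perm t t' b b' : inT R t -> inT R t' ->
    BHC_A b -> span_eq (b *m tauC R t) (tauC R t') ->
    BHC_A b' -> span_eq (b' *m tauC R t') (tauC R t) ->
  exists s : 'S_n, t' = col_perm s t.
Proof.
move=> tT tT' bB btt' bB' btt.
have [s le_s] := BHC_orbit_wt tT tT' bB btt'.
have [s' le_s'] := BHC_orbit_wt tT' tT bB' btt.
have [pp1 pp2 _] := tT; have [pp1' pp2' _] := tT'.
have E1 := perm_sum_eq (fun j => (le_s j).1) (fun j => (le_s' j).1).
have E2 := perm_sum_eq (fun j => (le_s j).2) (fun j => (le_s' j).2).
exists s; rewrite -[t']vsubmxK -[RHS]vsubmxK.
rewrite -/(tau1 t') -/(tau2 t') -/(tau1 _) -/(tau2 _).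
rewrite tau1_col_perm tau2_col_perm.
congr col_mx; apply/matrixP=> i j; rewrite [RHS]mxE.
  by apply: wt_inj pp1' pp1 (E1 j) i => // x y [/val_inj].
apply: wt_inj pp2' pp2 (E2 j) i => [x y|x]; last by rewrite subn_gt0.
move=> /(congr1 (subn n)); rewrite !subKn ?(ltnW (ltn_ord _)) //.
exact: val_inj.
Qed.

Lemma signed_pt_inj t (e e' : {set 'I_n}) :
    inT R t -> e \subset Dset t -> e' \subset Dset t ->
    BHequiv (@BH_A R n) (signed_pt t e) (signed_pt t e') -> e = e'.
Proof.
move=> tT /subsetP sD /subsetP sD' [h [a [a_unit ua ->]] /span_eqP[u _]].
rewrite mul_block_col !mul0mx addr0 add0r mul_col_mx => /eq_col_mx[E1 E2].
suff eqD j : j \in Dset t -> (j \in e) = (j \in e').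
  apply/setP=> j; case: (boolP (j \in Dset t)) => [/eqD //|jD].
  by rewrite (negPf (contra (sD j) jD)) (negPf (contra (sD' j) jD)).
move=> jD; have [i [t1ij t2ij]] := inT_row tT jD.
have [[T01 T1r T1c] [T02 T2r T2c] _] := tT.
(* The 1 at [(i, j)] is alone in its row and column, so the entry [(i, j)] of a product with [T]
   reads off a diagonal entry of the other factor. *)
have rowT (T : 'M[int]_n) (M : 'M[C]_n) : is_pp T -> T i j = 1 ->
    (intC T *m M) i j = M j j.
  case=> T0 Tr _ Tij; rewrite mxE (bigD1 j) //= mxE Tij mul1r big1 ?addr0 //.
  move=> k nkj; rewrite mxE; case: (T0 i k) => Tik; first by rewrite Tik mul0r.
  by rewrite (Tr _ _ _ Tik Tij) eqxx in nkj.
have colT (T : 'M[int]_n) (M : 'M[C]_n) : is_pp T -> T i j = 1 ->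
    (M *m intC T) i j = M i i.
  case=> T0 _ Tc Tij; rewrite mxE (bigD1 i) //= mxE Tij mulr1 big1 ?addr0 //.
  move=> k nki; rewrite mxE; case: (T0 k j) => Tkj; first by rewrite Tkj mulr0.
  by rewrite (Tc _ _ _ Tkj Tij) eqxx in nki.
have pp1 : is_pp (tau1 t) by []. have pp2 : is_pp (tau2 t) by [].
have := congr1 (fun M : 'M_n => M i j) E2.
rewrite colT // rowT // => ujj.
have := congr1 (fun M : 'M_n => M i j) E1.
rewrite mulmxA mul_signE colT // -mulmxA rowT // mul_diag_mx mxE -ujj.
have -> : invmx (adjn a) i i = (invmx a i i)^*.
  by rewrite -[adjn a]/(ctr Num.conj a) -ctrV ctrE.
have aV := upper_mx_inv_diag i a_unit ua.
have ai0 : a i i != 0 by apply: contra_eq_neq aV => ->; rewrite mul0r eq_sym oner_eq0.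
have -> : invmx a i i = (a i i)^-1 by apply: (mulfI ai0); rewrite aV mulfV.
have sq : 0 < a i i * (a i i)^* by rewrite mul_conjC_gt0.
have ac0 : (a i i)^* != 0 by rewrite conjC_eq0.
rewrite mxE fmorphV => /(congr1 (fun x => x * (a i i)^*)).
rewrite mulrAC mulfVK //.
case: (j \in e); case: (j \in e') => // E; move: sq.
  by rewrite -oppr_lt0 -mulrN1 E ltr10.
by rewrite -[_ * _]mulr1 E oppr_gt0 ltr10.
Qed.

End PartialPermutations.

(** * Normal forms of complex and of real Lagrangians *)

Section NormalForms.
Variables (R : realType) (n : nat).
Local Notation C := (R[i]).
Local Notation Pt := 'M[C]_(n + n, n).
Local Notation intC := (map_mx (fun z : int => z%:~R : C)).
Local Notation rc := (map_mx (real_complex R)).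

Lemma conj_norm_or_oppnorm (x : C) : Num.conj x = x -> x != 0 ->
  exists y, y * Num.conj y * x = 1 \/ y * Num.conj y * x = -1.
Proof.
move=> /CrealP xr nz; exists (sqrtC `|x|)^-1.
have nx : `|x| != 0 by rewrite normr_eq0.
have y0 : 0 <= (sqrtC `|x|)^-1 by rewrite invr_ge0 sqrtC_ge0.
rewrite (conj_Creal (ger0_real y0)) -expr2 exprVn sqrtCK.
case/orP: xr => [x0|x0]; [left|right].
  by rewrite -[X in _ * X]ger0_norm // mulVf.
by rewrite -[X in _ * X]opprK -(ler0_norm x0) mulrN mulVf.
Qed.

Lemma real_norm_or_oppnorm (x : R) : idfun x = x -> x != 0 ->
  exists y : R, y * idfun y * x = 1 \/ y * idfun y * x = -1.
Proof.
move=> _ nz; exists (Num.sqrt `|x|)^-1.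
have nx : `|x| != 0 by rewrite normr_eq0.
rewrite /= -expr2 exprVn sqr_sqrtr //.
have [x0|x0] := lerP 0 x; [left|right].
  by rewrite -[X in _ * X]ger0_norm // mulVf.
by rewrite -[X in _ * X]opprK -(ltr0_norm x0) mulrN mulVf.
Qed.

Lemma lagr_nf (X : Pt) : lagr X ->
  exists t (e : {set 'I_n}), [/\ inR R t, e \subset Dset t
                & BHequiv (@BH_A R n) X (signed_pt R t e)].
Proof.
rewrite -[X]vsubmxK => -[rkX /isotropic_col XH].
have two0 : (2 : C) != 0 by rewrite pnatr_eq0.
have [a [u [A [Q [ua a_unit u_unit [sQ QA] [X1E X2E]]]]]] :=
  lagrangian_nf (@conjCK _) two0 conj_norm_or_oppnorm rkX XH.
have [t [e [tR eD tE]]] := spp_signed_pt R sQ QA.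
exists t, e; split=> //; exists (block_mx (invmx a) 0 0 (ctr Num.conj a)).
  exists (invmx a); split; rewrite ?unitmx_inv //; first exact: upper_mxV.
  by rewrite -[adjn _]/(ctr Num.conj _) ctrV invmxK.
apply/span_eqP; exists u => //; rewrite tE mul_block_col.
by rewrite !mul0mx addr0 add0r mul_col_mx X2E X1E !mulmxA mulVmx // mul1mx.
Qed.

(** The reduction is carried out on a real basis, so that the base change is real, and scalars are
    extended afterwards. *)
Lemma lagr_real_nf (X : Pt) : lagr_real X ->
  exists t (e : {set 'I_n}), [/\ inR R t, e \subset Dset t
                & BHequiv (@BH_B R n) X (signed_pt R t e)].
Proof.
case=> X0 [lX XX0].
have two0 : (2 : R) != 0 by rewrite pnatr_eq0.
move: lX XX0; rewrite -[X0]vsubmxK map_col_mx.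
set X1 := usubmx X0; set X2 := dsubmx X0 => -[rkX /isotropic_col XH] XX0.
have ctR m p (M : 'M[R]_(m, p)) : ctr idfun M = M^T by rewrite /ctr map_mx_id.
have {}XH : ctr idfun X1 *m X2 = ctr idfun X2 *m X1.
  apply: (@map_mx_inj _ _ (real_complex R)).
  have trc (M : 'M[R]_n) : rc (ctr idfun M) = ctr Num.conj (rc M).
    by rewrite ctR /ctr cj_rc map_trmx.
  by rewrite !map_mxM !trc.
have {}rkX : \rank (col_mx X1 X2) = n.
  by rewrite -(mxrank_map (real_complex R)) map_col_mx.
have [a [u [A [Q [ua a_unit u_unit [sQ QA] [X1E X2E]]]]]] :=
  lagrangian_nf (fun x => erefl : idfun (idfun x) = x) two0 real_norm_or_oppnorm rkX XH.
have [t [e [tR eD tE]]] := spp_signed_pt R sQ QA.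
have PE : coproj C A = rc (coproj R A).
  apply/matrixP=> i j; rewrite !mxE; case: eqP => _; rewrite ?rmorph0 //.
  by rewrite !mulr1n rmorph_nat.
have QE : intC Q = rc (map_mx (fun z : int => z%:~R : R) Q).
  by apply/matrixP=> i j; rewrite !mxE rmorph_int.
exists t, e; split=> //.
exists (block_mx (invmx (rc a)) 0 0 (rc a)^T).
  exists (invmx (rc a)); split.
  - by rewrite unitmx_inv map_unitmx.
  - apply: upper_mxV; first by rewrite map_unitmx.
    by move=> i j ltji; rewrite mxE ua // rmorph0.
  - by apply/real_mxP; rewrite map_invmx cj_rc.
  by rewrite -trmx_inv invmxK.
apply: span_eq_trans (span_eq_mull _ XX0) _.
apply/span_eqP; exists (rc u); first by rewrite map_unitmx.
rewrite tE mul_block_col !mul0mx addr0 add0r mul_col_mx map_trmx.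
rewrite -map_invmx -!map_mxM -ctR X2E X1E !mulmxA mulVmx // mul1mx PE QE.
by rewrite !map_mxM map_mxD map_mxB map_mx1.
Qed.

End NormalForms.

(** * Real structures on the Borel subgroups *)

Lemma invmx_mul (K : fieldType) m (A B : 'M[K]_m) :
  A \in unitmx -> B \in unitmx -> invmx (A *m B) = invmx B *m invmx A.
Proof.
move=> A_unit B_unit; have AB_unit : A *m B \in unitmx by rewrite unitmx_mul A_unit.
apply: (can_inj (mulKmx AB_unit)).
by rewrite mulmxV // mulmxA mulmxK // mulmxV.
Qed.

Section RealStructures.
Variables (R : realType) (n : nat).
Local Notation C := (R[i]).
Local Notation M2 := 'M[C]_(n + n).
Local Notation Pt := 'M[C]_(n + n, n).
Local Notation "A ^ct" := (ctr Num.conj A) (at level 2, format "A ^ct").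
Local Notation cj := (map_mx (Num.conj : C -> C)).
Local Notation J := (@J_B R n).
Implicit Types (b c h : M2) (a : 'M[C]_n) (X Y : Pt).

Let cK : involutive (Num.conj : C -> C) := @conjCK _.

Lemma lower_ct a : upper a -> lower a^ct.
Proof. by move=> ua i j ltij; rewrite ctrE ua // rmorph0. Qed.

Lemma upper_ct a : lower a -> upper a^ct.
Proof. by move=> la i j ltij; rewrite ctrE la // rmorph0. Qed.

Lemma lowerM a a' : lower a -> lower a' -> lower (a *m a').
Proof.
move=> la la'; rewrite -(ctrK cK a) -(ctrK cK a') -ctrM.
by apply: lower_ct; apply: upper_mxM; apply: upper_ct.
Qed.

Lemma lowerV a : a \in unitmx -> lower a -> lower (invmx a).
Proof.
move=> a_unit la; rewrite -(ctrK cK (invmx a)) ctrV.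
by apply/lower_ct/upper_mxV; [rewrite ctr_unit | apply: upper_ct].
Qed.

Lemma lower1 : lower (1%:M : 'M[C]_n).
Proof. by rewrite -(ctr1 Num.conj); apply/lower_ct/upper_mx1. Qed.

Lemma block_diagM a1 a2 a1' a2' :
  block_mx a1 0 0 a2 *m block_mx a1' 0 0 a2' =
  block_mx (a1 *m a1') 0 0 (a2 *m a2').
Proof. by rewrite mulmx_block !mulmx0 !mul0mx !addr0 !add0r. Qed.

Lemma block_diag1 : block_mx 1%:M 0 0 1%:M = 1%:M :> M2.
Proof. by rewrite -scalar_mx_block. Qed.

Lemma block_diag_unit a1 a2 :
  a1 \in unitmx -> a2 \in unitmx -> block_mx a1 0 0 a2 \in unitmx.
Proof. by move=> u1 u2; rewrite unitmxE det_ublock unitrM -!unitmxE u1. Qed.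

Lemma invmx_block a1 a2 : a1 \in unitmx -> a2 \in unitmx ->
  invmx (block_mx a1 0 0 a2) = block_mx (invmx a1) 0 0 (invmx a2).
Proof. by move=> u1 u2; rewrite invmx_block_diag // block_diag_unit. Qed.

Lemma BHC_A_unit b : BHC_A b -> b \in unitmx.
Proof. by case=> a1 [a2 [u1 _ u2 _ ->]]; apply: block_diag_unit. Qed.

Lemma BHC_A1 : BHC_A (1%:M : M2).
Proof.
exists 1%:M, 1%:M; rewrite unitmx1 block_diag1; split=> //.
  exact: upper_mx1.
exact: lower1.
Qed.

Lemma BHC_AM b b' : BHC_A b -> BHC_A b' -> BHC_A (b *m b').
Proof.
case=> a1 [a2 [u1 ua1 u2 la2 ->]] [a1' [a2' [u1' ua1' u2' la2' ->]]].
exists (a1 *m a1'), (a2 *m a2'); rewrite block_diagM !unitmx_mul u1 u2.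
by split=> //; [apply: upper_mxM | apply: lowerM].
Qed.

Lemma BHC_AV b : BHC_A b -> BHC_A (invmx b).
Proof.
case=> a1 [a2 [u1 ua1 u2 la2 ->]].
exists (invmx a1), (invmx a2); rewrite invmx_block // !unitmx_inv.
by split=> //; [apply: upper_mxV | apply: lowerV].
Qed.

Lemma gamma_A_block a1 a2 : a1 \in unitmx -> a2 \in unitmx ->
  gamma_A (block_mx a1 0 0 a2) = block_mx (invmx a2^ct) 0 0 (invmx a1^ct).
Proof.
move=> u1 u2; rewrite /gamma_A.
have JA_unit : @J_A R n \in unitmx by rewrite unitmxZ ?unitfE ?neq0Ci // J_unit.
apply: (can_inj (mulKmx JA_unit)); rewrite !mulmxA mulmxV // mul1mx.
rewrite /adj map_block_mx tr_block_mx !map_mx0 !trmx0.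
rewrite invmx_block ?ctr_unit // J_AE -scalemxAl -scalemxAr; congr (_ *: _).
rewrite !mulmx_block !mulmx0 !mul0mx !mulmx1 !mul1mx !addr0 !add0r.
by rewrite mulmxN mulNmx mulmx1 mul1mx.
Qed.

Lemma gamma_A_BHC b : BHC_A b -> BHC_A (gamma_A b).
Proof.
case=> a1 [a2 [u1 ua1 u2 la2 ->]]; rewrite gamma_A_block //.
exists (invmx a2^ct), (invmx a1^ct); rewrite !unitmx_inv !ctr_unit.
split=> //; first by apply: upper_mxV; rewrite ?ctr_unit //; apply: upper_ct.
by apply: lowerV; rewrite ?ctr_unit //; apply: lower_ct.
Qed.

Lemma gamma_AK b : BHC_A b -> gamma_A (gamma_A b) = b.
Proof.
case=> a1 [a2 [u1 _ u2 _ ->]]; rewrite !gamma_A_block ?unitmx_inv ?ctr_unit //.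
by rewrite !ctrV !(ctrK cK) !invmxK.
Qed.

Lemma gamma_AM b b' : BHC_A b -> BHC_A b' ->
  gamma_A (b *m b') = gamma_A b *m gamma_A b'.
Proof.
case=> a1 [a2 [u1 ua1 u2 la2 ->]] [a1' [a2' [u1' ua1' u2' la2' ->]]].
rewrite block_diagM !gamma_A_block ?unitmx_mul ?u1 ?u2 // block_diagM !ctrM.
by rewrite !invmx_mul ?ctr_unit.
Qed.

Lemma BH_A_fix h : BH_A h <-> BHC_A h /\ gamma_A h = h.
Proof.
split=> [[a [u ua ->]]|[[a1 [a2 [u1 ua1 u2 la2 ->]]]]].
  have uct : a^ct \in unitmx by rewrite ctr_unit.
  split; last by rewrite gamma_A_block ?unitmx_inv // ctrV invmxK (ctrK cK).
  exists a, (invmx a^ct); rewrite unitmx_inv; split=> //.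
  by apply: lowerV => //; apply: lower_ct.
rewrite gamma_A_block // => /eq_block_mx[_ _ _ a2E].
by exists a1; split=> //; rewrite -a2E.
Qed.

(** [gamma_A] exchanges the two triangular factors, so a cocycle satisfies [a1 = a2^ct] and is
    trivialized by correcting the second factor alone. *)
Lemma H1_BHC_A c : BHC_A c -> c *m gamma_A c = 1%:M ->
  exists2 b, BHC_A b & invmx b *m gamma_A b = c.
Proof.
case=> a1 [a2 [u1 ua1 u2 la2 ->]]; rewrite gamma_A_block // block_diagM.
rewrite -block_diag1 => /eq_block_mx[a12 _ _ _].
exists (block_mx 1%:M 0 0 (invmx a2)).
  exists 1%:M, (invmx a2); rewrite unitmx1 unitmx_inv.
  by split=> //; [apply: upper_mx1 | apply: lowerV].
rewrite gamma_A_block ?unitmx1 ?unitmx_inv // invmx_block ?unitmx1 ?unitmx_inv //.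
rewrite block_diagM invmxK ctrV invmxK ctr1 !invmx1 mul1mx mulmx1.
by congr block_mx; rewrite -[LHS]mul1mx -a12 mulmxKV ?ctr_unit.
Qed.

Lemma BHC_B_A b : BHC_B b -> BHC_A b.
Proof.
case=> a [u ua ->]; exists a, (invmx a^T); rewrite unitmx_inv unitmx_tr.
split=> //; apply: lowerV; rewrite ?unitmx_tr // => i j ltij.
by rewrite mxE ua.
Qed.

Lemma BHC_B1 : BHC_B (1%:M : M2).
Proof.
exists 1%:M; rewrite unitmx1 trmx1 invmx1 block_diag1.
by split=> //; apply: upper_mx1.
Qed.

Lemma BHC_BM b b' : BHC_B b -> BHC_B b' -> BHC_B (b *m b').
Proof.
case=> a [u ua ->] [a' [u' ua' ->]].
exists (a *m a'); rewrite block_diagM !unitmx_mul u; split=> //.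
  exact: upper_mxM.
by rewrite trmx_mul invmx_mul ?unitmx_tr.
Qed.

Lemma BHC_BV b : BHC_B b -> BHC_B (invmx b).
Proof.
case=> a [u ua ->].
exists (invmx a); rewrite invmx_block ?unitmx_inv ?unitmx_tr //.
by split=> //; [apply: upper_mxV | rewrite trmx_inv].
Qed.

Lemma gamma_B_block a : gamma_B (block_mx a 0 0 (invmx a^T)) =
  block_mx (cj a) 0 0 (invmx (cj a)^T).
Proof. by rewrite /gamma_B map_block_mx !map_mx0 map_invmx map_trmx. Qed.

Lemma upper_cj a : upper a -> upper (cj a).
Proof. by move=> ua i j ltji; rewrite mxE ua // rmorph0. Qed.

Lemma gamma_B_BHC b : BHC_B b -> BHC_B (gamma_B b).
Proof.
case=> a [u ua ->]; rewrite gamma_B_block; exists (cj a).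
by rewrite map_unitmx; split=> //; apply: upper_cj.
Qed.

Lemma gamma_BK b : gamma_B (gamma_B b) = b.
Proof. by apply/matrixP=> i j; rewrite !mxE conjCK. Qed.

Lemma gamma_BM b b' : gamma_B (b *m b') = gamma_B b *m gamma_B b'.
Proof. exact: map_mxM. Qed.

Lemma BH_B_fix h : BH_B h <-> BHC_B h /\ gamma_B h = h.
Proof.
split=> [[a [u ua /real_mxP ar ->]]|[[a [u ua ->]]]].
  by split; [exists a | rewrite gamma_B_block ar].
rewrite gamma_B_block => /eq_block_mx[ar _ _ _].
by exists a; split=> //; apply/real_mxP.
Qed.

Lemma BH_B_A h : BH_B h -> BH_A h.
Proof.
by case=> a [u ua /real_mxP ar ->]; exists a; split=> //; rewrite /adjn ar.
Qed.

(* Hilbert 90: [d = y + cj (y a)] satisfies [cj d = d a]; the diagonal matrix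
   [y] keeps the diagonal of [d] away from zero. *)
Lemma hilbert90_upper a : a \in unitmx -> upper a -> a *m cj a = 1%:M ->
  exists d : 'M[C]_n, [/\ d \in unitmx, upper d & cj d = d *m a].
Proof.
move=> u ua aca.
(* The diagonal of [d] is [y_i + conj (y_i * a i i)]. With [y_i = 1] it vanishes exactly when
   [a i i = -1], and there [y_i = 'i] gives [2 'i]. *)
pose y : 'M[C]_n := diag_mx (\row_i (if a i i == -1 then 'i else 1)).
have caa : cj a *m a = 1%:M by apply: mulmx1C.
have uy : upper_mx y by move=> i j ltji; rewrite mxE -val_eqE /= gtn_eqF.
have uca : upper_mx (cj a) := upper_cj ua.
have ucy : upper_mx (cj y) := upper_cj uy.
have ub : upper_mx (y + cj (y *m a)).
  by move=> i j ltji; rewrite mxE uy // map_mxM upper_mxM // addr0.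
exists (y + cj (y *m a)); split=> //; last first.
  have cjK : cj (cj (y *m a)) = y *m a.
    by apply/matrixP=> i j; rewrite !mxE conjCK.
  by rewrite map_mxD cjK mulmxDl [in RHS]map_mxM -mulmxA caa mulmx1 addrC.
apply: upper_mx_unit => // i; rewrite mxE [cj _ _ _]mxE mul_diag_mx !mxE eqxx mulr1n.
case: (eqVneq (a i i) (-1)) => [->|aN1].
  by rewrite mulrN1 rmorphN /= conjCi opprK -mulr2n mulrn_eq0 neq0Ci.
rewrite mul1r addrC addr_eq0; apply: contraNneq aN1 => /(congr1 Num.conj) /=.
by rewrite conjCK rmorphN rmorph1 => ->.
Qed.

Lemma H1_BHC_B c : BHC_B c -> c *m gamma_B c = 1%:M ->
  exists2 b, BHC_B b & invmx b *m gamma_B b = c.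
Proof.
case=> a [u ua ->]; rewrite gamma_B_block block_diagM -block_diag1.
case/eq_block_mx=> aca _ _ _.
have [b [b_unit ub bE]] := hilbert90_upper u ua aca.
exists (block_mx b 0 0 (invmx b^T)); first by exists b.
rewrite gamma_B_block invmx_block ?unitmx_inv ?unitmx_tr // invmxK block_diagM.
rewrite bE mulKmx // trmx_mul invmx_mul ?unitmx_tr //.
by rewrite mulKVmx ?unitmx_tr.
Qed.

Lemma block_diag_J (x y z w : 'M[C]_n) :
  block_mx x 0 0 y *m J *m block_mx z 0 0 w =
  block_mx 0 (x *m w) (- (y *m z)) 0.
Proof.
rewrite !mulmx_block !mulmx0 !mul0mx !addr0 !add0r !mulmx1 mulmxN mulmx1.
by rewrite !mul0mx mulNmx.
Qed.

Lemma BHC_B_symplectic b : BHC_B b -> b^T *m J *m b = J.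
Proof.
case=> a [u ua ->]; rewrite tr_block_mx !trmx0 block_diag_J trmx_inv trmxK.
by rewrite mulVmx // mulmxV ?unitmx_tr.
Qed.

(* [gamma] sends [b [tau]] to its orthogonal for the Hermitian form. *)
Lemma gamma_A_dual b : BHC_A b -> b^ct *m J *m gamma_A b = J.
Proof.
case=> a1 [a2 [u1 _ u2 _ ->]]; rewrite gamma_A_block // /ctr map_block_mx.
by rewrite tr_block_mx !map_mx0 !trmx0 block_diag_J !mulmxV ?ctr_unit.
Qed.

(** The orthogonal of [X] has dimension [2n - n = n], so [X] and [Y], both contained in it, both
    fill it. *)
Lemma lagr_orthogonal X Y :
  lagr X -> \rank Y = n -> X^ct *m J *m Y = 0 -> span_eq Y X.
Proof.
case=> rkX isoX rkY XY; set N := X^ct *m J in XY.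
have rkN : \rank N = n.
  by rewrite /N mxrankMfree ?row_free_unit ?J_unit // mxrank_tr mxrank_map rkX.
have ker (Z : Pt) : \rank Z = n -> N *m Z = 0 -> (Z^T == kermx N^T)%MS.
  move=> rkZ NZ; have sZ : (Z^T <= kermx N^T)%MS.
    by apply/sub_kermxP; rewrite -trmx_mul NZ trmx0.
  by rewrite -(geq_leqif (mxrank_leqif_eq sZ)) mxrank_ker !mxrank_tr rkN rkZ addnK.
have /andP[Yk kY] := ker Y rkY XY; have /andP[Xk kX] := ker X rkX isoX.
by apply/andP; split; [apply: submx_trans kX | apply: submx_trans kY].
Qed.

End RealStructures.

(** * Real points in the orbit of tau *)

Section RealOrbits.
Variables (R : realType) (n : nat).
Local Notation C := (R[i]).
Local Notation M2 := 'M[C]_(n + n).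
Local Notation Pt := 'M[C]_(n + n, n).
Local Notation intC := (map_mx (fun z : int => z%:~R : C)).
Local Notation cj := (map_mx (Num.conj : C -> C)).
Local Notation J := (@J_B R n).
Local Notation tmat := 'M[int]_(n + n, n).
Implicit Types (b c h : M2) (X Y : Pt) (t : tmat) (e : {set 'I_n}).

Lemma cj_tauC t : cj (tauC R t) = tauC R t.
Proof. by apply/matrixP=> i j; rewrite !mxE rmorph_int. Qed.

Lemma tauC_J t : inR R t -> (tauC R t)^T *m J *m tauC R t = 0.
Proof.
case=> _ tS; have : isotropic (tauC R t); last by rewrite /isotropic /ctr cj_tauC.
rewrite tauCE; apply/isotropic_col.
have cjI (T : 'M[int]_n) : ctr Num.conj (intC T) = intC T^T.
  by apply/matrixP=> i j; rewrite !mxE rmorph_int.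
rewrite !cjI -!(map_mxM (intmul 1 : {rmorphism int -> C})).
by rewrite -[in LHS]tS trmx_mul trmxK.
Qed.

Lemma rank_tauC t : inR R t -> \rank (tauC R t) = n.
Proof. by case=> -[]. Qed.

Lemma tauC_lagr_real t : inR R t -> lagr_real (tauC R t).
Proof.
move=> tR; apply: real_span_lagr (rank_tauC tR) (tauC_J tR) _.
by rewrite cj_tauC; apply: span_eq_refl.
Qed.

Lemma orbit_B_J b t : inR R t -> BHC_B b ->
  (b *m tauC R t)^T *m J *m (b *m tauC R t) = 0.
Proof.
move=> tR bB; rewrite trmx_mul -!mulmxA (mulmxA J) (mulmxA b^T) (mulmxA b^T).
by rewrite BHC_B_symplectic // mulmxA tauC_J.
Qed.

Lemma signed_pt_lagr_real t e :
  inR R t -> e \subset Dset t -> lagr_real (signed_pt R t e).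
Proof.
move=> tR eD; have [b bB XE] := signed_pt_orbit tR.1 eD.
apply: real_span_lagr.
- rewrite (span_eq_rank XE) rank_mul_unit ?rank_tauC //.
  by apply/BHC_A_unit/BHC_B_A.
- case/span_eqP: XE => u _ ->; move: (orbit_B_J tR bB).
  move: (b *m tauC R t) => Y YJ; rewrite trmx_mul -!mulmxA.
  by rewrite (mulmxA J) (mulmxA Y^T) (mulmxA Y^T) YJ mul0mx mulmx0.
suff -> : cj (signed_pt R t e) = signed_pt R t e by apply: span_eq_refl.
rewrite map_col_mx map_mxM; congr (col_mx (_ *m _) _);
  apply/matrixP=> i j; rewrite !mxE ?rmorph_int //.
by rewrite rmorphMn /=; case: ifP; rewrite ?rmorphN rmorph1.
Qed.

(** Moves the real structure from the base point to [[tau]]: as tau is isotropic, [gamma_A b] tau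
    spans the orthogonal of [b] tau, and a point is Lagrangian when it equals its orthogonal. *)
Lemma real_A_orbit t b : inR R t -> BHC_A b ->
  (real_A (b *m tauC R t) <->
   span_eq (gamma_A b *m tauC R t) (b *m tauC R t)).
Proof.
move=> tR bB; have b_unit := BHC_A_unit bB; have gB := gamma_A_BHC bB.
have dual : ctr Num.conj (b *m tauC R t) *m J *m (gamma_A b *m tauC R t) = 0.
  move: (gamma_A_dual bB); move: (gamma_A b) => g bJg.
  rewrite ctrM -!mulmxA (mulmxA J) (mulmxA (ctr _ b)) (mulmxA (ctr _ b) J) bJg.
  by rewrite mulmxA /ctr cj_tauC tauC_J.
rewrite real_A_lagr; split=> [lX | /span_eq_sym/span_eqP[u _ XE]].
  apply: lagr_orthogonal lX _ dual.
  by rewrite rank_mul_unit ?rank_tauC // BHC_A_unit.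
split; first by rewrite rank_mul_unit ?rank_tauC.
by rewrite /isotropic [X in _ *m X = _]XE mulmxA dual mul0mx.
Qed.

Lemma real_B_orbit t b : inR R t -> BHC_B b ->
  (real_B (b *m tauC R t) <->
   span_eq (gamma_B b *m tauC R t) (b *m tauC R t)).
Proof.
move=> tR bB; have b_unit := BHC_A_unit (BHC_B_A bB).
have E : gamma_B b *m tauC R t = cj (b *m tauC R t) by rewrite map_mxM cj_tauC.
rewrite E; split=> [/real_B_cj // | cX].
apply/GP_B_real_B/lagr_real_GP_B/real_span_lagr => //.
  by rewrite rank_mul_unit ?rank_tauC.
exact: orbit_B_J.
Qed.

Lemma inR_col_perm (s : 'S_n) t :
  inT R (col_perm s t) -> inR R t -> inR R (col_perm s t).
Proof.
move=> tT [_]; rewrite trmx_mul trmxK => tS; split=> //.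
rewrite tau1_col_perm tau2_col_perm !col_permE !trmx_mul !trmxK -!mulmxA.
by rewrite (mulmxA (tau2 t)^T) tS !mulmxA.
Qed.

End RealOrbits.

(** * The classification from the structure of the groups *)

Section Classification.
Variables (R : realType) (n : nat).
Local Notation C := (R[i]).
Local Notation M2 := 'M[C]_(n + n).
Local Notation Pt := 'M[C]_(n + n, n).
Local Notation tmat := 'M[int]_(n + n, n).
Implicit Types (b c h s : M2) (X Y : Pt) (t : tmat) (e : {set 'I_n}).

Variables (BHC BH Hgrp : M2 -> Prop) (gamma : M2 -> M2) (realpt GP : Pt -> Prop).
(** The sandwich between the two cases: the larger group separates the orbits, and the smaller one
    contains the elements that remove signs. *)
Hypothesis BHC_sub : forall b, BHC b -> BHC_A b.
Hypothesis sub_BHC : forall b, BHC_B b -> BHC b.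
Hypothesis BHC1 : BHC 1%:M.
Hypothesis BHCM : forall b b', BHC b -> BHC b' -> BHC (b *m b').
Hypothesis BHCV : forall b, BHC b -> BHC (invmx b).
Hypothesis gamma_BHC : forall b, BHC b -> BHC (gamma b).
Hypothesis gammaK : forall b, BHC b -> gamma (gamma b) = b.
Hypothesis gammaM : forall b b', BHC b -> BHC b' ->
  gamma (b *m b') = gamma b *m gamma b'.
Hypothesis BH_fix : forall h, BH h <-> BHC h /\ gamma h = h.
Hypothesis BH_sub : forall h, BH h -> BH_A h.
Hypothesis H1_BHC : forall c, BHC c -> c *m gamma c = 1%:M ->
  exists2 b, BHC b & invmx b *m gamma b = c.
Hypothesis realpt_orbit : forall t b, inR R t -> BHC b ->
  (realpt (b *m tauC R t) <-> span_eq (gamma b *m tauC R t) (b *m tauC R t)).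
Hypothesis realptP : forall X, realpt X <-> GP X.
Hypothesis GP_span : forall X Y, span_eq X Y -> GP Y -> GP X.
Hypothesis GP_signed : forall t e, inR R t -> e \subset Dset t ->
  GP (signed_pt R t e).
Hypothesis GP_nf : forall X, GP X -> exists t e,
  [/\ inR R t, e \subset Dset t & BHequiv BH X (signed_pt R t e)].
Hypothesis Hgrp_unit : forall h, Hgrp h -> h \in unitmx.
Hypothesis HgrpV : forall h, Hgrp h -> Hgrp (invmx h).
Hypothesis BH_Hgrp : forall h, BH h -> Hgrp h.
Hypothesis GP_Hgrp : forall h X, Hgrp h -> GP X -> GP (h *m X).

Let BHC_unit b : BHC b -> b \in unitmx.
Proof. by move/BHC_sub; apply: BHC_A_unit. Qed.

Let gamma_unit b : BHC b -> gamma b \in unitmx.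
Proof. by move/gamma_BHC/BHC_unit. Qed.

Let gamma1 : gamma 1%:M = 1%:M.
Proof.
apply: (can_inj (mulKmx (gamma_unit BHC1))).
by rewrite -(gammaM BHC1 BHC1) !mulmx1.
Qed.

Let gammaV b : BHC b -> gamma (invmx b) = invmx (gamma b).
Proof.
move=> bB; apply: (can_inj (mulKmx (gamma_unit bB))).
by rewrite -(gammaM bB (BHCV bB)) !mulmxV ?gamma1 ?gamma_unit ?BHC_unit.
Qed.

Let BHV h : BH h -> BH (invmx h).
Proof.
by move=> /BH_fix[hB hE]; apply/BH_fix; split; [apply: BHCV | rewrite gammaV ?hE].
Qed.

Lemma cohomP t c c' : cohom BHC gamma t c c' <->
  exists2 s, Bstab BHC t s & s *m c' = c *m gamma s.
Proof.
split=> -[s ss E]; exists s => //; have s_unit := BHC_unit ss.1.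
  by rewrite E -mulmxA mulKVmx.
by rewrite -mulmxA -E mulKmx.
Qed.

Lemma cohom_refl t c : cohom BHC gamma t c c.
Proof.
apply/cohomP; exists 1%:M; rewrite ?gamma1 ?mulmx1 ?mul1mx //.
by split; rewrite ?mul1mx //; apply: span_eq_refl.
Qed.

Lemma Bstab_mul t s s' : Bstab BHC t s -> Bstab BHC t s' -> Bstab BHC t (s *m s').
Proof.
case=> sB st [sB' st']; split; first exact: BHCM.
by rewrite -mulmxA; apply: span_eq_trans (span_eq_mull s st') st.
Qed.

Lemma cohom_trans t c c' c'' :
  cohom BHC gamma t c c' -> cohom BHC gamma t c' c'' -> cohom BHC gamma t c c''.
Proof.
move=> /cohomP[s ss E] /cohomP[s' ss' E']; apply/cohomP.
exists (s *m s'); first exact: Bstab_mul.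
by rewrite -mulmxA E' mulmxA E (gammaM ss.1 ss'.1) mulmxA.
Qed.

Lemma BHequiv_sym X Y : BHequiv BH X Y -> BHequiv BH Y X.
Proof.
case=> h hB hX; exists (invmx h); first exact: BHV.
have [hB' _] := iffLR (BH_fix h) hB.
rewrite -[X in span_eq _ X](mulKmx (BHC_unit hB')).
exact/span_eq_mull/span_eq_sym.
Qed.

Lemma BHequiv_span X Y Z : BHequiv BH X Y -> span_eq Y Z -> BHequiv BH X Z.
Proof. by case=> h hB hX YZ; exists h => //; apply: span_eq_trans YZ. Qed.

Lemma coboundary_cocycle t b : inR R t -> BHC b -> realpt (b *m tauC R t) ->
  cocycle BHC gamma t (invmx b *m gamma b).
Proof.
move=> tR bB /(realpt_orbit tR bB) gb; have b_unit := BHC_unit bB.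
split; last first.
  rewrite (gammaM (BHCV bB) (gamma_BHC bB)) gammaV // gammaK //.
  rewrite mulmxA mulmxK ?gamma_unit //.
  exact: mulVmx.
split; first by apply: BHCM; [apply: BHCV | apply: gamma_BHC].
rewrite -[X in span_eq _ X](mulKmx b_unit) -mulmxA; exact: span_eq_mull.
Qed.

(** The dictionary is [s = b^-1 h^-1 b']: this [s] relates the two cocycles exactly when [gamma]
    fixes [h], and it stabilizes [[tau]] exactly when [h] maps one point to the other. *)
Lemma BHequiv_cohom t b b' : BHC b -> BHC b' ->
  (BHequiv BH (b *m tauC R t) (b' *m tauC R t) <->
   cohom BHC gamma t (invmx b *m gamma b) (invmx b' *m gamma b')).
Proof.
move=> bB bB'; have b_unit := BHC_unit bB; have b_unit' := BHC_unit bB'.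
rewrite cohomP; split=> [[h /BH_fix[hB hE] hbt] | [s [sB st] E]].
  have h_unit := BHC_unit hB.
  exists (invmx b *m invmx h *m b').
    split; first by apply: BHCM => //; apply: BHCM; apply: BHCV.
    rewrite -[X in span_eq _ X](mulKmx b_unit).
    rewrite -[X in span_eq _ (_ *m X)](mulKmx h_unit) -!mulmxA.
    by do 2![apply: span_eq_mull]; apply: span_eq_sym.
  rewrite (gammaM (BHCM (BHCV bB) (BHCV hB)) bB') (gammaM (BHCV bB) (BHCV hB)).
  rewrite !gammaV // hE !mulmxA mulmxK //.
  by rewrite mulmxK ?gamma_unit.
have s_unit := BHC_unit sB.
exists (b' *m invmx s *m invmx b).
  apply/BH_fix; split.
    by apply: BHCM; [apply: BHCM => //; apply: BHCV | apply: BHCV].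
  rewrite (gammaM (BHCM bB' (BHCV sB)) (BHCV bB)) (gammaM bB' (BHCV sB)).
  rewrite !gammaV //.
  have -> : gamma b' = b' *m invmx s *m (invmx b *m gamma b *m gamma s).
    by rewrite -E !mulmxA mulmxKV // mulmxV // mul1mx.
  by rewrite !mulmxA mulmxK ?gamma_unit // mulmxK ?gamma_unit.
rewrite -!mulmxA mulKmx //; apply: span_eq_mull.
rewrite -[X in span_eq _ X](mulKmx s_unit).
exact/span_eq_mull/span_eq_sym.
Qed.

(** In the whole Borel subgroup [c = b^-1 gamma(b)]. As [c] stabilizes [[tau]], the points [gamma(b)
    [tau]] and [b [tau]] coincide, which makes the latter real. *)
Lemma cocycle_coboundary t c : inR R t -> cocycle BHC gamma t c ->
  exists b, [/\ BHC b, realpt (b *m tauC R t)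
              & cohom BHC gamma t c (invmx b *m gamma b)].
Proof.
move=> tR [[cB ct] cc]; have [b bB bE] := H1_BHC cB cc.
exists b; split=> //; last by rewrite bE; apply: cohom_refl.
apply/(realpt_orbit tR bB).
have -> : gamma b = b *m c by rewrite -bE mulKVmx ?BHC_unit.
by rewrite -mulmxA; apply: span_eq_mull.
Qed.

(* Both groups embed in those of Case (A), whose orbits already separate the
   classes of [t]. *)
Lemma BHequiv_orbit_col_perm t t' X Y b b' :
    inT R t -> inT R t' -> BHC_A b -> BHC_A b' ->
    span_eq X (b *m tauC R t) -> span_eq Y (b' *m tauC R t') ->
    BHequiv BH X Y ->
  exists s : 'S_n, t' = col_perm s t.
Proof.
move=> tT tT' bB bB' Xt Yt' [h hB hXY].
have [hB' _] := iffLR (BH_A_fix h) (BH_sub hB).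
have gB : BHC_A (invmx b' *m h *m b).
  by apply: BHC_AM => //; apply: BHC_AM => //; apply: BHC_AV.
have g_tt' : span_eq (invmx b' *m h *m b *m tauC R t) (tauC R t').
  rewrite -[X in span_eq _ X](mulKmx (BHC_A_unit bB')) -!mulmxA.
  apply: span_eq_mull; apply: span_eq_trans _ Yt'; apply: span_eq_trans _ hXY.
  exact/span_eq_mull/span_eq_sym.
have g_unit := BHC_A_unit gB.
apply: (BHC_orbit_col_perm tT tT' gB g_tt' (BHC_AV gB)).
rewrite -[X in span_eq _ X](mulKmx g_unit).
exact/span_eq_mull/span_eq_sym.
Qed.

Lemma signed_pt_BHC t e : inR R t -> e \subset Dset t ->
  Borbit BHC t (signed_pt R t e).
Proof.
move=> tR eD; have [b bB XE] := signed_pt_orbit tR.1 eD.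
by exists b => //; apply: sub_BHC.
Qed.

(** The normal form may produce another [t']; lying in the same orbit, it is a column permutation of
    [t], and the signs are carried along by that permutation. *)
Lemma real_orbit_cover t X : inR R t -> Borbit BHC t X -> GP X ->
  exists2 e : {set 'I_n}, e \subset Dset t & BHequiv BH X (signed_pt R t e).
Proof.
move=> tR [b /BHC_sub bB Xb] /GP_nf[t' [e' [tR' eD' Xe]]].
have [b' bB' eb'] := signed_pt_BHC tR' eD'.
have [s tE] := BHequiv_orbit_col_perm tR'.1 tR.1 (BHC_sub bB') bB eb' Xb
  (BHequiv_sym Xe).
have [s' tE'] := BHequiv_orbit_col_perm tR.1 tR'.1 bB (BHC_sub bB') Xb eb' Xe.
exists (s' @: e'); first by apply: Dset_col_perm; rewrite -tE'.
by apply: BHequiv_span Xe _; rewrite tE'; apply: signed_pt_col_perm.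
Qed.

Lemma signed_pt_BH_inj t e e' : inR R t -> e \subset Dset t ->
  e' \subset Dset t -> BHequiv BH (signed_pt R t e) (signed_pt R t e') -> e = e'.
Proof.
move=> tR eD eD' [h hB hE]; apply: (signed_pt_inj tR.1 eD eD').
by exists h => //; apply: BH_sub.
Qed.

Lemma real_orbit_classificationP t :
  inR R t -> real_orbit_classification BHC BH gamma realpt t.
Proof.
move=> tR; have cob := coboundary_cocycle tR; have triv := cocycle_coboundary tR.
(* The existential is put outside the implication so that finite choice gives a function on all
   sets; 0 is the default value for those not contained in [Dset t]. *)
have reps e : exists b, e \subset Dset t ->
    [/\ BHC b, realpt (b *m tauC R t) & span_eq (signed_pt R t e) (b *m tauC R t)].
  have [eD|_] := boolP (e \subset Dset t); last by exists 0.
  have [b bB eb] := signed_pt_BHC tR eD; exists b; split=> //.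
  by apply/realptP; apply: GP_span (GP_signed tR eD); apply: span_eq_sym.
have [br brP] := fin_all_exists reps.
split=> //.
- by move=> b b' bB bB' _ _; apply: BHequiv_cohom.
- exists (fun e => invmx (br e) *m gamma (br e)); split=> [e /brP[]|c cc|e e' eD eD'].
  + by move=> bB br_real _; apply: cob.
  + have [b [bB breal cb]] := triv c cc.
    have bX : Borbit BHC t (b *m tauC R t) by exists b => //; apply: span_eq_refl.
    have [e eD be] := real_orbit_cover tR bX (iffLR (realptP _) breal).
    exists e => //; apply: cohom_trans cb _; have [bB' _ eb] := brP e eD.
    by apply/BHequiv_cohom => //; apply: BHequiv_span be eb.
  have [bB _ eb] := brP e eD; have [bB' _ eb'] := brP e' eD'.
  move=> /(BHequiv_cohom t bB bB') ee'; apply: (signed_pt_BH_inj tR eD eD').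
  apply: BHequiv_span (span_eq_sym eb').
  by apply/BHequiv_sym; apply: BHequiv_span (span_eq_sym eb); apply/BHequiv_sym.
exists (signed_pt R t); split=> [e eD|X Xt /realptP|e e' eD eD'].
- by split; [apply: signed_pt_BHC | apply/realptP; apply: GP_signed].
- exact: real_orbit_cover.
- exact: signed_pt_BH_inj.
Qed.

Lemma global_classificationP : global_classification BH Hgrp GP.
Proof.
have BH1 : BH 1%:M by apply/BH_fix.
split=> [h X hH hX|X Y _ _|S [SR Scover Sinj]].
- exists (invmx h *m X); first by apply: GP_Hgrp => //; apply: HgrpV.
  exists (invmx h); split; [exact: HgrpV | | exact: span_eq_refl].
  by rewrite /= mulVmx ?Hgrp_unit // invmx1 mulmx1.
- split=> [[k [kH /=]]|[h hB hXY]].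
    by rewrite !mulmx1 => /BHV; rewrite invmxK => kB kXY; exists k.
  by exists h; rewrite /= !mulmx1; split; [apply: BH_Hgrp | apply: BHV |].
exists (fun t => signed_pt R t); split=> [t e tS eD|X /GP_nf|t t' e e' tS tS' eD eD' ee'].
- by apply: GP_signed => //; apply: SR.
- case=> t' [e' [tR' eD' Xe']]; have [t tS [s tE]] := Scover t' tR'.
  exists t, (s @: e'); split=> //; first by apply: Dset_col_perm; rewrite -tE.
  by apply: BHequiv_span Xe' _; rewrite tE; apply: signed_pt_col_perm.
have tR := SR t tS; have tR' := SR t' tS'.
have [b bB eb] := signed_pt_BHC tR eD; have [b' bB' eb'] := signed_pt_BHC tR' eD'.
have ett' : t' = t.
  apply: (Sinj _ _ tS' tS).
  exact: BHequiv_orbit_col_perm tR.1 tR'.1 (BHC_sub bB) (BHC_sub bB') eb eb' ee'.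
rewrite ett' in ee' eD' *; split=> //.
exact: signed_pt_BH_inj tR eD eD' ee'.
Qed.

End Classification.

(** * The groups of the two cases and their real points *)

Section Groups.
Variables (R : realType) (n : nat).
Local Notation C := (R[i]).
Local Notation M2 := 'M[C]_(n + n).
Local Notation Pt := 'M[C]_(n + n, n).
Local Notation J := (@J_B R n).
Implicit Types (g h : M2) (X : Pt).

Lemma H_A_unit h : H_A h -> h \in unitmx.
Proof.
by case=> a u ->; apply: block_diag_unit; rewrite ?unitmx_inv ?[_ \in _]ctr_unit.
Qed.

Lemma H_AV h : H_A h -> H_A (invmx h).
Proof.
case=> a u ->; exists (invmx a); first by rewrite unitmx_inv.
rewrite invmx_block ?unitmx_inv ?[_ \in _]ctr_unit //.
by rewrite -![adjn _]/(ctr Num.conj _) ctrV.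
Qed.

Lemma H_A_isometry h : H_A h -> ctr Num.conj h *m J *m h = J.
Proof.
case=> a u ->; rewrite -[adjn a]/(ctr Num.conj a) /ctr map_block_mx tr_block_mx.
rewrite !map_mx0 !trmx0 block_diag_J -!/(ctr _ _) ctrV.
rewrite (ctrK (@conjCK _)) mulVmx // mulmxV ?ctr_unit //.
Qed.

Lemma H_B_unit h : H_B h -> h \in unitmx.
Proof.
by case=> a [u _ ->]; apply: block_diag_unit; rewrite ?unitmx_inv ?unitmx_tr.
Qed.

Lemma H_BV h : H_B h -> H_B (invmx h).
Proof.
case=> a [u /real_mxP ar ->]; exists (invmx a); rewrite unitmx_inv; split=> //.
  by apply/real_mxP; rewrite map_invmx ar.
by rewrite invmx_block ?unitmx_inv ?unitmx_tr // trmx_inv.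
Qed.

Lemma H_B_G_B h : H_B h -> G_B h.
Proof.
case=> a [u /real_mxP ar ->]; split.
  rewrite /Sp_C tr_block_mx !trmx0 block_diag_J trmx_inv trmxK.
  by rewrite mulVmx // mulmxV ?unitmx_tr.
by apply/real_mxP; rewrite map_block_mx ar !map_mx0 map_invmx -map_trmx ar.
Qed.

Lemma BH_A_H_A h : BH_A h -> H_A h.
Proof. by case=> a [u _ ->]; exists a. Qed.

Lemma BH_B_H_B h : BH_B h -> H_B h.
Proof. by case=> a [u _ ar ->]; exists a. Qed.

Lemma GP_A_H_A h X : H_A h -> GP_A X -> GP_A (h *m X).
Proof.
move=> /H_A_isometry hJ [g /G_A_isometry gJ XE]; exists (h *m g).
  apply/G_A_isometry; rewrite ctrM -!mulmxA (mulmxA J) (mulmxA (ctr _ h)).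
  by rewrite (mulmxA (ctr _ h)) hJ mulmxA.
by rewrite -mulmxA; apply: span_eq_mull.
Qed.

Lemma GP_B_H_B h X : H_B h -> GP_B X -> GP_B (h *m X).
Proof.
move=> /H_B_G_B[hJ /real_mxP hr] [g [gJ /real_mxP gr] XE]; exists (h *m g).
  split; last by apply/real_mxP; rewrite map_mxM hr gr.
  rewrite /Sp_C trmx_mul -!mulmxA (mulmxA J) (mulmxA h^T) (mulmxA h^T) hJ.
  by rewrite mulmxA.
by rewrite -mulmxA; apply: span_eq_mull.
Qed.

Lemma real_A_GP_A X : real_A X <-> GP_A X.
Proof. by rewrite real_A_lagr GP_A_lagr. Qed.

Lemma real_B_GP_B X : real_B X <-> GP_B X.
Proof. by split=> [/real_B_lagr/lagr_real_GP_B | /GP_B_real_B]. Qed.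

Lemma GP_A_span X Y : span_eq X Y -> GP_A Y -> GP_A X.
Proof. by move=> XY [g gG YE]; exists g => //; apply: span_eq_trans YE. Qed.

Lemma GP_B_span X Y : span_eq X Y -> GP_B Y -> GP_B X.
Proof. by move=> XY [g gG YE]; exists g => //; apply: span_eq_trans YE. Qed.

Lemma GP_A_signed t (e : {set 'I_n}) :
  inR R t -> e \subset Dset t -> GP_A (signed_pt R t e).
Proof.
by move=> tR eD; apply/GP_A_lagr/lagr_real_lagr/signed_pt_lagr_real.
Qed.

Lemma GP_B_signed t (e : {set 'I_n}) :
  inR R t -> e \subset Dset t -> GP_B (signed_pt R t e).
Proof. by move=> tR eD; apply/lagr_real_GP_B/signed_pt_lagr_real. Qed.

Lemma GP_A_nf X : GP_A X -> exists t (e : {set 'I_n}),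
  [/\ inR R t, e \subset Dset t & BHequiv (@BH_A R n) X (signed_pt R t e)].
Proof. by move=> /GP_A_lagr/lagr_nf. Qed.

Lemma GP_B_nf X : GP_B X -> exists t (e : {set 'I_n}),
  [/\ inR R t, e \subset Dset t & BHequiv (@BH_B R n) X (signed_pt R t e)].
Proof. by move=> /GP_B_real_B/real_B_lagr/lagr_real_nf. Qed.

Lemma BH_A_BHC h : BH_A h -> BHC_A h.
Proof. by case/BH_A_fix. Qed.

(** The normal form of a real point yields some [t'] satisfying [inR] in the same complex orbit, so
    [t] is a column permutation of [t'] and inherits the symmetry. *)
Lemma real_A_orbit_inR t : inT R t ->
  (exists X, Borbit (@BHC_A R n) t X /\ real_A X) -> inR R t.
Proof.
move=> tT [X [[b bB Xb] /real_A_GP_A/GP_A_nf[t' [e [tR' eD Xe]]]]].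
have [b' /BHC_B_A bB' eb'] := signed_pt_orbit tR'.1 eD.
have Xe' : BHequiv (@BH_A R n) (signed_pt R t' e) X.
  case: Xe => h hB hX; exists (invmx h).
    by case: hB => a [u ua ->]; exists (invmx a); rewrite unitmx_inv;
       rewrite invmx_block ?unitmx_inv ?[_ \in _]ctr_unit //;
       split; [|apply: upper_mxV|rewrite -![adjn _]/(ctr Num.conj _) ctrV].
  rewrite -[X in span_eq _ X](mulKmx (BHC_A_unit (BH_A_BHC hB))).
  exact/span_eq_mull/span_eq_sym.
have [s tE] := BHequiv_orbit_col_perm (fun h hB => hB) tR'.1 tT bB' bB eb' Xb Xe'.
by rewrite tE in tT *; apply: inR_col_perm.
Qed.

End Groups.

Theorem theorem1p25 (R : realType) (n : nat) :
  [/\ (* (1), Case (A) *)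
      (forall t : 'M[int]_(n + n, n), inT R t ->
         ((exists X, Borbit (@BHC_A R n) t X /\ real_A X) <-> inR R t)),
      (* (1), Case (B) *)
      (forall t : 'M[int]_(n + n, n), inR R t ->
         exists X, Borbit (@BHC_B R n) t X /\ real_B X),
      (* (2), Case (A) and Case (B) *)
      (forall t : 'M[int]_(n + n, n), inR R t ->
         real_orbit_classification (@BHC_A R n) (@BH_A R n) (@gamma_A R n) (@real_A R n) t /\
         real_orbit_classification (@BHC_B R n) (@BH_B R n) (@gamma_B R n) (@real_B R n) t),
      (* consequence, Case (A) *)
      global_classification (@BH_A R n) (@H_A R n) (@GP_A R n)
    & (* consequence, Case (B) *)
      global_classification (@BH_B R n) (@H_B R n) (@GP_B R n)].
Proof.
have tauA t : Borbit (@BHC_A R n) t (tauC R t).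
  by exists 1%:M; [apply: BHC_A1 | rewrite mul1mx; apply: span_eq_refl].
have tauB t : Borbit (@BHC_B R n) t (tauC R t).
  by exists 1%:M; [apply: BHC_B1 | rewrite mul1mx; apply: span_eq_refl].
split=> [t tT|t tR|t tR||].
- split=> [|tR]; first exact: real_A_orbit_inR.
  exists (tauC R t); split=> //.
  exact/real_A_lagr/lagr_real_lagr/tauC_lagr_real.
- by exists (tauC R t); split=> //; apply/GP_B_real_B/lagr_real_GP_B/tauC_lagr_real.
- split.
    exact: (@real_orbit_classificationP R n (@BHC_A R n) (@BH_A R n)
      (@gamma_A R n) (@real_A R n) (@GP_A R n) (fun _ => id) (@BHC_B_A R n)
      (BHC_A1 R n) (@BHC_AM R n) (@BHC_AV R n) (@gamma_A_BHC R n)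
      (@gamma_AK R n) (@gamma_AM R n) (@BH_A_fix R n) (fun _ => id)
      (@H1_BHC_A R n) (@real_A_orbit R n) (@real_A_GP_A R n) (@GP_A_span R n)
      (@GP_A_signed R n) (@GP_A_nf R n) t tR).
  exact: (@real_orbit_classificationP R n (@BHC_B R n) (@BH_B R n)
    (@gamma_B R n) (@real_B R n) (@GP_B R n) (@BHC_B_A R n) (fun _ => id)
    (BHC_B1 R n) (@BHC_BM R n) (@BHC_BV R n) (@gamma_B_BHC R n)
    (fun b _ => gamma_BK b) (fun b b' _ _ => gamma_BM b b') (@BH_B_fix R n)
    (@BH_B_A R n) (@H1_BHC_B R n) (@real_B_orbit R n) (@real_B_GP_B R n)
    (@GP_B_span R n) (@GP_B_signed R n) (@GP_B_nf R n) t tR).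
- exact: (@global_classificationP R n (@BHC_A R n) (@BH_A R n) (@H_A R n)
    (@gamma_A R n) (@GP_A R n) (fun _ => id) (@BHC_B_A R n)
    (BHC_A1 R n) (@BHC_AV R n) (@gamma_A_BHC R n) (@gamma_AM R n)
    (@BH_A_fix R n) (fun _ => id) (@GP_A_signed R n) (@GP_A_nf R n)
    (@H_A_unit R n) (@H_AV R n) (@BH_A_H_A R n) (@GP_A_H_A R n)).
exact: (@global_classificationP R n (@BHC_B R n) (@BH_B R n) (@H_B R n)
  (@gamma_B R n) (@GP_B R n) (@BHC_B_A R n) (fun _ => id)
  (BHC_B1 R n) (@BHC_BV R n) (@gamma_B_BHC R n) (fun b b' _ _ => gamma_BM b b')
  (@BH_B_fix R n) (@BH_B_A R n) (@GP_B_signed R n) (@GP_B_nf R n)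
  (@H_B_unit R n) (@H_BV R n) (@BH_B_H_B R n) (@GP_B_H_B R n)).
Qed.
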